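(* Let $X=X(\mathbb{R}^d,\mu)$ be a Banach lattice and let $\varepsilon>0$. Assume that there is a constant $B>0$ such that $$\left\|\frac{\partial}{\partial x_i}g_\sigma\right\|_X\le B\sigma\|g_\sigma\|_X,\qquad i=1,\dots,d,\quad g_\sigma\in\mathcal{B}_X^\sigma.$$ Then, for all $g_\sigma\in\mathcal{B}_X^\sigma$ and $W\ge\left(\frac{dB}{\log2}+\varepsilon\right)\sigma$, $$\|g_\sigma\|_X\asymp\bigg\|\sum_{k\in\mathbb{Z}^d}|g_\sigma(x_k)|\chi_{\Omega_k}\bigg\|_X,$$ where $x_k$ is an arbitrary point in $\Omega_k=\left[\frac{k_1-1}W,\frac{k_1}W\right]\times\dots\times\left[\frac{k_d-1}W,\frac{k_d}W\right]$, $k\in\mathbb{Z}^d$.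
   Context: $\mu$ is a positive $\sigma$-finite measure on $\mathbb{R}^d$. A Banach (function) lattice $X=X(\mathbb{R}^d,\mu)$ is a Banach space of functions on $\mathbb{R}^d$ with a functional $\|\cdot\|_X$ such that: 1) $\|f\|_X=0$ iff $f=0$; 2) $\|\lambda f\|_X=|\lambda|\|f\|_X$ for $\lambda\in\mathbb{C}$; 3) $\|f+g\|_X\le\|f\|_X+\|g\|_X$; 4) if $|f|\le|g|$ then $\|f\|_X\le\|g\|_X$ for $f,g\in X$; 5) $\chi_B\in X$ for all $B$ with $\mu(B)<\infty$; the paper's standing convention also assumes $X\subset L_1$. For $\sigma>0$, the class of band-limited functions is $\mathcal{B}_X^\sigma=\{\varphi\in X\cap L_1(\mathbb{R}^d):\operatorname{supp}\widehat\varphi\subset Q(0,\sigma)\}$, where $Q(0,\sigma)=\{y\in\mathbb{R}^d:\|y\|_\infty\le\sigma\}$ and $\widehat g(x)=\int_{\mathbb{R}^d}g(y)e^{-i(x,y)}dy$. $A\asymp B$ means two-sided inequalities with positive constants independent of the essential variables (here $\sigma$, $W$, $g_\sigma$, and the points $x_k$). *)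

(* Defs.v *)
From HB Require Import structures.
From mathcomp Require Import all_boot all_order all_algebra.
From mathcomp Require Import all_classical all_reals all_analysis.
From mathcomp Require Import complex.

Set Implicit Arguments.
Unset Strict Implicit.
Unset Printing Implicit Defensive.

Import Order.TTheory GRing.Theory Num.Theory.
Import numFieldNormedType.Exports.

Local Open Scope classical_set_scope.
Local Open Scope ring_scope.

(* The library has no sigma-algebra on row vectors and no Lebesgue measure in
   dimension d: both are built here. The sigma-algebra generated by the
   coordinates is the Borel sigma-algebra of R^n. *)
Definition measure_rV_display : measure_display.
Proof. exact: default_measure_display. Qed.

Section measurable_rV.
Context {R : realType} (n : nat).

Let coors : 'I_n -> 'rV[R]_n -> measurableTypeR R := fun i x => x 0 i.

Let rV_set0 : g_sigma_preimage coors set0.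
Proof. exact: sigma_algebra0. Qed.

Let rV_setC A : g_sigma_preimage coors A -> g_sigma_preimage coors (~` A).
Proof. exact: sigma_algebraC. Qed.

Let rV_bigcup (F : (set 'rV[R]_n)^nat) :
  (forall i, g_sigma_preimage coors (F i)) ->
  g_sigma_preimage coors (\bigcup_i (F i)).
Proof. exact: sigma_algebra_bigcup. Qed.

HB.instance Definition _ := @isMeasurable.Build measure_rV_display
  'rV[R]_n (g_sigma_preimage coors) rV_set0 rV_setC rV_bigcup.

End measurable_rV.

Lemma measurable_coord (R : realType) n (i : 'I_n) :
  measurable_fun [set: 'rV[R]_n] (fun x : 'rV[R]_n => x 0 i : measurableTypeR R).
Proof.
move=> _ Y mY; rewrite setTI; apply: sub_sigma_algebra => /=.
rewrite -bigcup_seq/=; exists i => /=; first by rewrite mem_index_enum.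
by exists Y => //; rewrite setTI.
Qed.

Lemma measurable_fun_rV (R : realType) d (T : measurableType d) n
    (f : T -> 'rV[R]_n) :
  (forall i, measurable_fun [set: T] (fun x => f x 0 i : measurableTypeR R)) ->
  measurable_fun [set: T] f.
Proof.
move=> mf.
have H : (@measurable _ 'rV[R]_n) `<=`
    [set A | measurable (f @^-1` A)].
  apply: smallest_sub.
    split => /=.
    - by rewrite preimage_set0.
    - by move=> A mA; rewrite setTD preimage_setC; exact: measurableC.
    - by move=> F mF; rewrite preimage_bigcup; exact: bigcup_measurable.
  rewrite -bigcup_seq; apply: bigcup_sub => i _ A [B mB <-] /=.
  by rewrite setTI; have := mf i measurableT B mB; rewrite setTI.
by move=> _ A mA; rewrite setTI; exact: H.
Qed.

Section lebesgue_rV.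
Context {R : realType}.

Definition row_cons n (p : measurableTypeR R * 'rV[R]_n) : 'rV[R]_n.+1 :=
  row_mx (const_mx p.1 : 'rV_1) p.2.

Definition row_uncons n (v : 'rV[R]_n.+1) : measurableTypeR R * 'rV[R]_n :=
  (v 0 ord0, \row_j v 0 (lift ord0 j)).

Lemma row_cons0 n p : @row_cons n p 0 ord0 = p.1.
Proof.
by rewrite mxE; case: splitP => [j _|//]; rewrite mxE.
Qed.

Lemma row_consS n p (j : 'I_n) : row_cons p 0 (lift ord0 j) = p.2 0 j.
Proof.
rewrite mxE; case: splitP => [[[|//] ?] //|k /= [jk]].
by congr (p.2 0 _); exact/val_inj.
Qed.

Lemma row_consK n : cancel (@row_cons n) (@row_uncons n).
Proof.
move=> p; rewrite /row_uncons row_cons0 [RHS]surjective_pairing.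
by congr pair; apply/rowP => j; rewrite mxE row_consS.
Qed.

Lemma measurable_row_cons n : measurable_fun setT (@row_cons n).
Proof.
apply: measurable_fun_rV => i.
case: (unliftP ord0 i) => [j ->|->].
  under eq_fun do rewrite row_consS.
  exact: (measurableT_comp (measurable_coord j) measurable_snd).
under eq_fun do rewrite row_cons0.
exact: measurable_fst.
Qed.

Lemma measurable_row_uncons n : measurable_fun setT (@row_uncons n).
Proof.
apply: measurable_fun_pair => /=; first exact: measurable_coord.
apply: measurable_fun_rV => i.
under eq_fun do rewrite mxE.
exact: measurable_coord.
Qed.

Section step.
Context n (mu : {sigma_finite_measure set 'rV[R]_n -> \bar R}).

Definition lebesgue_step : set 'rV[R]_n.+1 -> \bar R :=
  pushforward (lebesgue_measure \x mu)%E (@row_cons n).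

Let step0 : lebesgue_step set0 = 0%E.
Proof. by rewrite /lebesgue_step /pushforward preimage_set0 measure0. Qed.

Let step_ge0 A : (0 <= lebesgue_step A)%E.
Proof. by rewrite /lebesgue_step /pushforward measure_ge0. Qed.

Let step_additive : semi_sigma_additive lebesgue_step.
Proof.
have := @measure_semi_sigma_additive _ _ _
  (measure_function_pushforward__canonical__measure_function_Measure
     (lebesgue_measure \x mu)%E (@measurable_row_cons n)).
exact.
Qed.

HB.instance Definition _ := isMeasure.Build _ _ _ lebesgue_step
  step0 step_ge0 step_additive.

Let step_sigma_finite : sigma_finite setT lebesgue_step.
Proof.
have /sigma_finiteP[F [FT ndF Foo]] := sigma_finiteT (@lebesgue_measure R).
have /sigma_finiteP[G [GT ndG Goo]] := sigma_finiteT mu.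
exists (fun k => @row_uncons n @^-1` (F k `*` G k)).
  apply/seteqP; split=> // v _.
  have [i _ Fi] : (\bigcup_k F k) (row_uncons v).1 by rewrite -FT.
  have [j _ Gj] : (\bigcup_k G k) (row_uncons v).2 by rewrite -GT.
  exists (maxn i j) => //; split.
  - by move: Fi; exact/subsetPset/ndF/leq_maxl.
  - by move: Gj; exact/subsetPset/ndG/leq_maxr.
move=> k; have [mF Fk] := Foo k; have [mG Gk] := Goo k; split.
  by rewrite -[X in measurable X]setTI; apply: measurable_row_uncons => //;
    exact: measurableX.
rewrite /lebesgue_step /pushforward -comp_preimage.
rewrite (_ : _ \o _ = id); last exact/funext/row_consK.
rewrite preimage_id product_measure1E//.
by rewrite lte_mul_pinfty// ge0_fin_numE.
Qed.

HB.instance Definition _ := Measure_isSigmaFinite.Build _ _ _ lebesgue_step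
  step_sigma_finite.

End step.

Fixpoint lebesgue_rV n : {sigma_finite_measure set 'rV[R]_n -> \bar R} :=
  match n with
  | 0 => dirac (0 : 'rV[R]_0)
  | m.+1 => lebesgue_step (lebesgue_rV m)
  end.

Lemma lebesgue_rV_box n (a b : 'rV[R]_n) :
  (forall i, a 0 i <= b 0 i) ->
  let box := [set x : 'rV[R]_n | forall i, a 0 i <= x 0 i <= b 0 i] in
  measurable box /\ lebesgue_rV n box = (\prod_i (b 0 i - a 0 i))%:E.
Proof.
elim: n a b => [|n IH] a b ab /=.
  rewrite big_ord0 (_ : mkset _ = setT); first by split=> //; exact: diracT.
  by apply/seteqP; split=> // x _ [].
pose a' : 'rV[R]_n := \row_j a 0 (lift ord0 j).
pose b' : 'rV[R]_n := \row_j b 0 (lift ord0 j).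
pose box' := [set x : 'rV[R]_n | forall i, a' 0 i <= x 0 i <= b' 0 i].
have [|mbox' Ebox'] := IH a' b'; first by move=> i; rewrite !mxE.
have mX : measurable ((`[a 0 ord0, b 0 ord0] : set (measurableTypeR R)) `*` box').
  exact: measurableX.
have -> : [set x : 'rV[R]_n.+1 | forall i, a 0 i <= x 0 i <= b 0 i] =
    @row_uncons n @^-1` (`[a 0 ord0, b 0 ord0] `*` box').
  apply/seteqP; split=> [x ax|x [/= x0 x']].
    split; first by rewrite /= in_itv /= ax.
    by move=> i; rewrite !mxE.
  move=> i; case: (unliftP ord0 i) => [j ->|->].
    by have := x' j; rewrite !mxE.
  by move: x0; rewrite in_itv.
split.
  by rewrite -[X in measurable X]setTI; exact: measurable_row_uncons.
rewrite /lebesgue_step /pushforward -comp_preimage.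
rewrite (_ : _ \o _ = id); last exact/funext/row_consK.
rewrite preimage_id product_measure1E// Ebox' big_ord_recl EFinM.
congr (_ * _)%E; last by congr _%:E; apply: eq_bigr => i _; rewrite !mxE.
transitivity (lebesgue_measure (`[a 0 ord0, b 0 ord0] : set R)); first by [].
rewrite lebesgue_measure_itv /= lte_fin.
by have := ab ord0; rewrite le_eqVlt => /orP[/eqP ->|->//]; rewrite ltxx subrr.
Qed.

End lebesgue_rV.

Local Open Scope complex_scope.

Section complex_functions.
Context {R : realType} d (T : measurableType d).
Implicit Types f : T -> R[i].

Definition cmeasurable f :=
  measurable_fun setT (fun x => complex.Re (f x)) /\
  measurable_fun setT (fun x => complex.Im (f x)).

Definition cintegrable (mu : {measure set T -> \bar R}) f :=
  mu.-integrable setT (fun x => (complex.Re (f x))%:E) /\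
  mu.-integrable setT (fun x => (complex.Im (f x))%:E).

Definition cintegral (mu : {measure set T -> \bar R}) f : R[i] :=
  (\int[mu]_x complex.Re (f x)) +i* (\int[mu]_x complex.Im (f x)).

End complex_functions.

(* Functions are considered modulo equality mu-almost everywhere. The lattice
   axiom is the usual (solid) one of Banach function spaces: a measurable
   function dominated by an element of X is in X. *)
Record banach_lattice (R : realType) (d : nat)
    (mu : {measure set 'rV[R]_d -> \bar R}) := BanachLattice {
  bl_carrier :> ('rV[R]_d -> R[i]) -> Prop ;
  bl_norm : ('rV[R]_d -> R[i]) -> R ;
  bl_measurable : forall f, bl_carrier f -> cmeasurable f ;
  bl_carrier0 : bl_carrier (fun=> 0) ;
  bl_carrierD : forall f g, bl_carrier f -> bl_carrier g ->
    bl_carrier (fun x => f x + g x) ;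
  bl_carrierZ : forall (a : R[i]) f, bl_carrier f ->
    bl_carrier (fun x => a * f x) ;
  bl_norm_eq0 : forall f, bl_carrier f ->
    bl_norm f = 0 <-> {ae mu, forall x, f x = 0} ;
  bl_normZ : forall (a : R[i]) f, bl_carrier f ->
    bl_norm (fun x => a * f x) = ComplexField.Normc.normc a * bl_norm f ;
  bl_normD : forall f g, bl_carrier f -> bl_carrier g ->
    bl_norm (fun x => f x + g x) <= bl_norm f + bl_norm g ;
  bl_solid : forall f g, cmeasurable f -> bl_carrier g ->
    {ae mu, forall x, `|f x| <= `|g x|} ->
    bl_carrier f /\ bl_norm f <= bl_norm g ;
  bl_indic : forall A : set 'rV[R]_d, measurable A -> (mu A < +oo)%E ->
    bl_carrier (fun x => (\1_A x)%:C) ;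
  bl_complete : forall u : nat -> 'rV[R]_d -> R[i],
    (forall n, bl_carrier (u n)) ->
    (forall e : R, 0 < e -> exists N, forall m n, (N <= m)%N -> (N <= n)%N ->
      bl_norm (fun x => u m x - u n x) < e) ->
    exists2 f, bl_carrier f &
      (fun n => bl_norm (fun x => u n x - f x)) @ \oo --> (0 : R)
}.

Section band_limited.
Context {R : realType} {d : nat}.
Implicit Types (f g : 'rV[R]_d -> R[i]) (x y : 'rV[R]_d).

Definition dotr x y : R := \sum_(i < d) x 0 i * y 0 i.

Definition cexpi (t : R) : R[i] := cos t +i* sin t.

Definition fourier f : 'rV[R]_d -> R[i] := fun xi =>
  cintegral (lebesgue_rV d) (fun y => f y * cexpi (- dotr xi y)).

(* The norm of a row vector is its sup norm. *)
Definition cube (sigma : R) : set 'rV[R]_d := [set y | `|y| <= sigma].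

(* An integrable function with compactly supported Fourier transform agrees
   Lebesgue-almost everywhere with a unique continuous (in fact entire)
   function. Point values and partial derivatives are those of that function,
   hence the continuity requirement. *)
Definition band_limited (mu : {measure set 'rV[R]_d -> \bar R})
    (X : banach_lattice mu) (sigma : R) f :=
  [/\ X f,
      cintegrable (lebesgue_rV d) f,
      continuous (fun x => complex.Re (f x)) /\
      continuous (fun x => complex.Im (f x)) &
      closure [set xi | fourier f xi != 0] `<=` cube sigma].

Definition partial_derivative (i : 'I_d) f : 'rV[R]_d -> R[i] := fun x =>
  ('D_(delta_mx 0 i) (fun y => complex.Re (f y)) x) +i*
  ('D_(delta_mx 0 i) (fun y => complex.Im (f y)) x).

Definition grid_cube (W : R) (k : 'rV[int]_d) : set 'rV[R]_d :=
  [set x | forall i, (k 0 i - 1)%:~R / W <= x 0 i <= (k 0 i)%:~R / W].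

(* For W > 0 a point lies in at most 2 ^ d of the closed cubes, so that the
   sum over all k has finite support. *)
Definition sampling (W : R) (t : 'rV[int]_d -> 'rV[R]_d) g :
    'rV[R]_d -> R[i] := fun x =>
  (\sum_(k \in [set: 'rV[int]_d])
     ComplexField.Normc.normc (g (t k)) * \1_(grid_cube W k) x)%:C.

End band_limited.

(* Main.v *)
Require Import Defs.
From HB Require Import structures.
From mathcomp Require Import all_boot all_order all_algebra.
From mathcomp Require Import all_classical all_reals all_analysis.
From mathcomp Require Import measurable_realfun complex zify ring lra.

Set Implicit Arguments.
Unset Strict Implicit.
Unset Printing Implicit Defensive.

Import Order.TTheory GRing.Theory Num.Theory.
Import numFieldNormedType.Exports.

Local Open Scope classical_set_scope.
Local Open Scope ring_scope.

(* Let g be band-limited and let x, x_k lie in the same cube of side 1 / W. The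
   Taylor expansion of g at x, not at x_k, gives
     |g x_k - g x| <= E x := \sum_(m >= 1) W^-m / m! \sum_(|w| = m) |d_w g x|,
   where w ranges over the words in the d partial derivatives. The Bernstein
   inequality applied m times bounds the norm of d_w g by (B sigma)^m |g|, so
   |E| <= (exp (d B sigma / W) - 1) |g| <= q |g| with q < 1, and at most 2^d
   closed cubes contain x, which yields both estimates. By completeness and the
   lattice property the series E is dominated a.e. by an element of X of norm
   at most q |g|.

   To iterate the Bernstein inequality one needs that d_i g is again
   band-limited, in particular Lebesgue integrable. Fourier inversion (by
   Gaussian summation) represents g as the inverse transform of a bounded
   function supported in the cube, which gives smoothness and the convergence
   of Taylor series. For h sigma <= 1 / 2 the identity asin (sin t) = t turns
   h d_i g into an absolutely convergent series of translates of g, because the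
   Taylor coefficients of asin are nonnegative with sum at most pi / 2; hence
   d_i g is integrable and its transform vanishes where that of g does. *)

(** * Integrals of real functions *)

(** Expanding at [x] makes the majorant a function of [x] alone, the same for every choice of sample
    points, so its norm in [X] can be estimated. An expansion at [x_k] would involve point values of
    derivatives, which the norm of [X] does not control. The threshold comes from exp b - 1 < 1
    exactly when b < log 2, and [eps] keeps q away from 1 uniformly. Since [mu] is unrelated to
    Lebesgue measure, membership of a derivative in [X] says nothing about its Lebesgue
    integrability. Translates settle this: finite combinations of translates of a band-limited
    function are clearly band-limited, and translation preserves the L1 norm, so dominated
    convergence carries integrability and spectrum to the limit. The analysis is done on real
    functions with the kernel cos(x.xi + th). The phases 0 and pi / 2 give real and imaginary parts,
    a derivative adds pi / 2 to the phase, and a translation shifts it. Complex functions return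
    only once band-limitedness has been reduced to real and imaginary parts. *)

Section real_integrals.
Context d (T : measurableType d) (R : realType).
Context (mu : {measure set T -> \bar R}).
Implicit Types (D : set T) (f g : T -> R).

Lemma le_integrable_EFin D f g : measurable D -> measurable_fun D f ->
  mu.-integrable D (EFin \o g) -> (forall x, D x -> `|f x| <= g x) ->
  mu.-integrable D (EFin \o f).
Proof.
move=> mD mf ig fg; apply: (le_integrable mD _ _ ig).
  exact/measurable_EFinP.
by move=> x Dx; rewrite /= lee_fin (le_trans (fg _ Dx))// ler_norm.
Qed.

Lemma integrable_EFinD D f g : measurable D -> mu.-integrable D (EFin \o f) ->
  mu.-integrable D (EFin \o g) -> mu.-integrable D (EFin \o (fun x => f x + g x)).
Proof. by move=> mD; exact: integrableD. Qed.

Lemma integrable_EFinZ D k f : measurable D -> mu.-integrable D (EFin \o f) ->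
  mu.-integrable D (EFin \o (fun x => k * f x)).
Proof. by move=> mD; exact: integrableZl. Qed.

Lemma integrable_EFinB D f g : measurable D -> mu.-integrable D (EFin \o f) ->
  mu.-integrable D (EFin \o g) -> mu.-integrable D (EFin \o (fun x => f x - g x)).
Proof.
move=> mD iff ig; apply: (integrable_EFinD mD iff).
by rewrite /comp; under eq_fun do rewrite EFinN; exact: integrableN.
Qed.

Lemma EFin_Rintegral D f : measurable D -> mu.-integrable D (EFin \o f) ->
  (\int[mu]_(x in D) f x)%:E = (\int[mu]_(x in D) (f x)%:E)%E.
Proof. by move=> mD intf; rewrite /Rintegral fineK//; exact: integrable_fin_num. Qed.

Lemma integrable_EFin_measurable D f : mu.-integrable D (EFin \o f) ->
  measurable_fun D f.
Proof. by move=> /measurable_int/measurable_EFinP. Qed.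

(** The majorant is extended-real because the one used for the arcsine series is an infinite sum of
    nonnegative functions, which may be infinite at some points. *)
Lemma dominated_cvg_Rintegral_ereal D (f_ : nat -> T -> R) f (g : T -> \bar R) :
  measurable D -> (forall n, measurable_fun D (f_ n)) -> mu.-integrable D g ->
  (forall n x, D x -> (`|f_ n x|%:E <= g x)%E) ->
  (forall x, D x -> f_ ^~ x @ \oo --> f x) ->
  mu.-integrable D (EFin \o f) /\
  (fun n => \int[mu]_(x in D) f_ n x) @ \oo --> \int[mu]_(x in D) f x.
Proof.
move=> mD mf_ ig f_g f_f.
have mf : measurable_fun D f by apply: measurable_fun_cvg f_f.
have [|||||intf _] := @dominated_convergence _ _ _ mu D mD
  (fun n x => (f_ n x)%:E) (EFin \o f) g.
- by move=> n; exact/measurable_EFinP.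
- exact/measurable_EFinP.
- by apply: aeW => x Dx; apply: cvg_EFin; [exact: nearW|exact: f_f].
- exact: ig.
- by apply/aeW => x n Dx; exact: f_g.
move=> H; split => //.
by apply: fine_cvg; rewrite fineK//; exact: integrable_fin_num.
Qed.

Lemma dominated_cvg_Rintegral D (f_ : nat -> T -> R) f g : measurable D ->
  (forall n, measurable_fun D (f_ n)) -> mu.-integrable D (EFin \o g) ->
  (forall n x, D x -> `|f_ n x| <= g x) ->
  (forall x, D x -> f_ ^~ x @ \oo --> f x) ->
  mu.-integrable D (EFin \o f) /\
  (fun n => \int[mu]_(x in D) f_ n x) @ \oo --> \int[mu]_(x in D) f x.
Proof. by move=> mD mf_ ig f_g; apply: dominated_cvg_Rintegral_ereal mf_ ig _. Qed.

Lemma le_normr_RintegralW D f g : measurable D -> measurable_fun D f ->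
  mu.-integrable D (EFin \o g) -> (forall x, D x -> `|f x| <= g x) ->
  `|\int[mu]_(x in D) f x| <= \int[mu]_(x in D) g x.
Proof.
move=> mD mf ig fg; have intf := le_integrable_EFin mD mf ig fg.
apply: (le_trans (le_normr_Rintegral mD intf)).
by apply: le_Rintegral => //; exact: integrable_norm.
Qed.

End real_integrals.

(** * Characteristic function of the normal law *)

Section gauss_characteristic_function.
Context {R : realType}.
Notation leb := (@lebesgue_measure R).
Implicit Types (s t x th : R).

Lemma is_derive_normal_pdf s x : s != 0 ->
  is_derive x 1 (normal_pdf 0 s) (- (x / s ^+ 2) * normal_pdf 0 s x).
Proof.
move=> s0; rewrite normal_pdfE//.
set f := (X in is_derive _ _ X).
have -> : f = (fun x => normal_peak s * expR (- (s ^+ 2 *+ 2)^-1 * x ^+ 2)).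
  by apply/funext => y; rewrite /f /normal_fun subr0 !mulNr [y ^+ 2 / _]mulrC.
apply: is_derive_eq => /=; rewrite /GRing.scale /= /normal_fun subr0.
have -> : - x ^+ 2 / (s ^+ 2 *+ 2) = - (s ^+ 2 *+ 2)^-1 * x ^+ 2 by rewrite !mulNr mulrC.
rewrite -[_ *+ 2]mulr_natr invfM.
by field.
Qed.

Lemma measurable_cos_affine t th : measurable_fun setT (fun x => cos (t * x + th)).
Proof.
apply: measurableT_comp.
  by apply: continuous_measurable_fun; exact: continuous_cos.
by apply: measurable_funD => //; exact: measurable_funM.
Qed.

Lemma normal_peak2 s : normal_peak (2 * s) = normal_peak s / 2.
Proof.
rewrite /normal_peak exprMn -mulrA -mulrnAr sqrtrM ?sqr_ge0// sqrtr_sqr.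
by rewrite ger0_norm// invfM mulrC.
Qed.

(** The split 1/2 = 1/8 + 3/8 of the exponent: one part is a Gaussian of doubled width, still
    integrable, and the other is a decaying factor left to absorb moments and tails. *)
Lemma normal_pdf2 m s x : s != 0 -> normal_pdf m s x =
  2 * normal_pdf m (2 * s) x * expR (- (3 / 8 * ((x - m) / s) ^+ 2)).
Proof.
move=> s0; have s20 : 2 * s != 0 by rewrite mulf_neq0.
rewrite !normal_pdfE//= normal_peak2.
have -> : normal_fun m s x =
    normal_fun m (2 * s) x * expR (- (3 / 8 * ((x - m) / s) ^+ 2)).
  rewrite /normal_fun -expRD; congr expR.
  rewrite -[s ^+ 2 *+ 2]mulr_natr -[(2 * s) ^+ 2 *+ 2]mulr_natr.
  by field.
by field.
Qed.

Lemma normr_normal_pdf_le s x : s != 0 ->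
  `|x * normal_pdf 0 s x| <= (2 * `|s|) * normal_pdf 0 (2 * s) x.
Proof.
move=> s0; rewrite normrM (ger0_norm (normal_pdf_ge0 _ _ _)) normal_pdf2// subr0.
set y := x / s; set N := normal_pdf _ _ _; set E := expR _.
have -> : `|x| = `|y| * `|s| by rewrite -normrM /y divfK.
rewrite [leLHS](_ : _ = (2 * `|s| * N) * (`|y| * E)); last by ring.
rewrite ler_piMr ?mulr_ge0 ?normal_pdf_ge0//.
rewrite /E expRN ler_pdivrMr ?expR_gt0// mul1r; apply: le_trans (expR_ge1Dx _).
rewrite -[y ^+ 2]real_normK ?num_real//.
(* The minimum of 3/8 y^2 - y is at 4/3, so this square gives |y| <= 3/8 y^2 + 2/3. *)
have : 0 <= (`|y| - 4 / 3) ^+ 2 by exact: sqr_ge0.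
by lra.
Qed.

Lemma integrable_moment_normal_pdf s : s != 0 ->
  leb.-integrable setT (EFin \o (fun x => `|x * normal_pdf 0 s x|)).
Proof.
move=> s0; apply: (@le_integrable_EFin _ _ _ leb setT _
  (fun x => (2 * `|s|) * normal_pdf 0 (2 * s) x)) => //.
- apply: measurableT_comp => //; apply: measurable_funM => //.
  exact: measurable_normal_pdf.
- under [X in integrable _ _ X]eq_fun do rewrite /= EFinM.
  by apply: integrableZl => //; exact: integrable_normal_pdf.
- by move=> x _; rewrite normr_id normr_normal_pdf_le.
Qed.

(** The fundamental theorem of calculus on [-(n+1), n+1], then dominated convergence. The successor
    keeps the interval nondegenerate. *)
Lemma Rintegral_derive0 (H h : R -> R) : (forall x, is_derive x 1 H (h x)) ->
  continuous h -> leb.-integrable setT (EFin \o h) ->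
  H (n.+1%:R) @[n --> \oo] --> 0 -> H (- n.+1%:R) @[n --> \oo] --> 0 ->
  \int[leb]_x h x = 0.
Proof.
move=> dH ch ih Hp Hn.
have mh : measurable_fun setT h by exact: continuous_measurable_fun.
pose h_ n := h \_ `[- (n.+1)%:R, (n.+1)%:R].
have [||||_] := @dominated_cvg_Rintegral _ _ _ leb setT h_ h (fun x => `|h x|) measurableT.
- move=> n; apply/measurable_restrict => //; rewrite setTI.
  exact: measurable_funS mh.
- exact: integrable_norm.
- by move=> n x _; rewrite /h_ patchE; case: ifP => // _; rewrite normr0.
- move=> x _; apply: cvg_near_cst; near=> n.
  rewrite /h_ patchE mem_set//= in_itv/= -ler_norml.
  rewrite (le_trans _ (_ : n%:R <= _)) ?ler_nat//.
  by near: n; exact: nbhs_infty_ger.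
move=> cv.
have E n : \int[leb]_x h_ n x = H (n.+1)%:R - H (- (n.+1)%:R).
  rewrite -Rintegral_mkcond /Rintegral (@continuous_FTC2 _ h H)//.
  - by rewrite (@lt_trans _ _ 0)// oppr_lt0.
  - exact: continuous_subspaceT.
  - have cH x : H y @[y --> x] --> H x.
      by apply: differentiable_continuous; apply/derivable1_diffP; exact: ex_derive.
    by split=> [x _||]; [exact: ex_derive|exact: cvg_at_right_filter|exact: cvg_at_left_filter].
  - by move=> x _; rewrite derive1E; apply: derive_val.
apply: (cvg_unique (@norm_hausdorff _ R) cv).
rewrite (_ : (fun n => _) = (fun n => H (n.+1)%:R - H (- (n.+1)%:R))); last exact/funext.
have -> : (0 : R) = 0 - 0 by rewrite subr0.
exact: cvgB.
Unshelve. all: by end_near. Qed.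

Lemma measurable_cos_normal_pdf s t th :
  measurable_fun setT (fun x => cos (t * x + th) * normal_pdf 0 s x).
Proof.
apply: measurable_funM; first exact: measurable_cos_affine.
exact: measurable_normal_pdf.
Qed.

Lemma integrable_cos_normal_pdf s t th : leb.-integrable setT
  (EFin \o (fun x => cos (t * x + th) * normal_pdf 0 s x)).
Proof.
apply: (@le_integrable_EFin _ _ _ leb setT _ (normal_pdf 0 s) measurableT
  (measurable_cos_normal_pdf s t th)); first exact: integrable_normal_pdf.
move=> x _; rewrite normrM (ger0_norm (normal_pdf_ge0 _ _ _)).
by rewrite ler_piMl ?normal_pdf_ge0// ler_norml cos_geN1 cos_le1.
Qed.

(** As a function of t the integral G solves G' = - s^2 t G: differentiate under the integral sign
    and integrate by parts. Hence G(t) exp((s t)^2 / 2) is constant, equal to its value cos th at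
    0. *)
Lemma Rintegral_cos_normal_pdf s t th : s != 0 ->
  \int[leb]_x (cos (t * x + th) * normal_pdf 0 s x) =
  cos th * expR (- ((s * t) ^+ 2 / 2)).
Proof.
move=> s0.
have mq := @measurable_normal_pdf R 0 s.
have iq := @integrable_normal_pdf R 0 s.
have mf t' th' := @measurable_cos_normal_pdf s t' th'.
have intf t' th' := @integrable_cos_normal_pdf s t' th'.
pose G t' := \int[leb]_x (cos (t' * x + th) * normal_pdf 0 s x).
pose F (t' x : R) := cos (t' * x + th) * normal_pdf 0 s x.
have dF t' x : is_derive t' 1 (fun t' => cos (t' * x + th) * normal_pdf 0 s x)
    (- (x * sin (t' * x + th) * normal_pdf 0 s x)).
  by apply: is_derive_eq; rewrite /GRing.scale /=; ring.
have d1F t' x : partial1of2 F t' x = - (x * sin (t' * x + th) * normal_pdf 0 s x).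
  by rewrite /partial1of2 derive1E; apply: derive_val.
have xq_le t' x : `|- (x * sin (t' * x + th) * normal_pdf 0 s x)| <= `|x * normal_pdf 0 s x|.
  rewrite normrN mulrAC normrM ler_piMr// ler_norml.
  by rewrite sin_geN1 sin_le1.
have ixq := integrable_moment_normal_pdf s0.
have dG t' : is_derive t' 1 G (\int[leb]_x (- (x * sin (t' * x + th) * normal_pdf 0 s x))).
  have It' : `]t' - 1, t' + 1[%classic t'.
    by rewrite /= in_itv/= ltrDl ltr01 andbT ltrBlDr ltrDl.
  have side : [/\ forall x, `]t' - 1, t' + 1[%classic x -> leb.-integrable setT (EFin \o F x),
      forall x y, `]t' - 1, t' + 1[%classic x -> setT y -> derivable (F ^~ y) x 1 &
      forall x y, `]t' - 1, t' + 1[%classic x -> setT y ->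
        `|partial1of2 F x y| <= `|y * normal_pdf 0 s y|].
    split=> [x _|x y _ _|x y _ _]; first exact: intf.
      exact: (@ex_derive _ _ _ _ _ _ _ (dF x y)).
    by rewrite d1F xq_le.
  case: side => i1 i2 i3.
  have i4 x : 0 <= `|x * normal_pdf 0 s x| by exact: normr_ge0.
  apply: DeriveDef.
    exact: (derivable_under_integral measurableT It' i1 i2 i4 ixq i3).
  rewrite -derive1E (differentiation_under_integral measurableT It' i1 i2 i4 ixq i3).
  by apply: eq_Rintegral => x _; rewrite d1F.
have msin t' : measurable_fun setT (fun x => x * sin (t' * x + th) * normal_pdf 0 s x).
  apply: measurable_funM => //; apply: measurable_funM => //.
  apply: measurableT_comp; first by apply: continuous_measurable_fun; exact: continuous_sin.
  by apply: measurable_funD => //; exact: measurable_funM.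
have isin t' : leb.-integrable setT
    (EFin \o (fun x => x * sin (t' * x + th) * normal_pdf 0 s x)).
  apply: (@le_integrable_EFin _ _ _ leb setT _ _ measurableT (msin t') ixq).
  by move=> x _; rewrite -normrN xq_le.
have parts t' : \int[leb]_x (x * sin (t' * x + th) * normal_pdf 0 s x) = s ^+ 2 * t' * G t'.
  (* Integration by parts: [H] vanishes at infinity, so its derivative [h], which combines the
     integrand of [G] with the sine moment, integrates to zero. *)
  pose H x := sin (t' * x + th) * normal_pdf 0 s x.
  pose h x := t' * (cos (t' * x + th) * normal_pdf 0 s x) -
    s ^- 2 * (x * sin (t' * x + th) * normal_pdf 0 s x).
  have dH x : is_derive x 1 H (h x).
    have dq := is_derive_normal_pdf x s0.
    by apply: is_derive_eq; rewrite /GRing.scale /= /h; field.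
  have ih1 : leb.-integrable setT (EFin \o (fun x => t' * (cos (t' * x + th) * normal_pdf 0 s x))).
    by apply: (@integrable_EFinZ _ _ _ leb) => //; exact: intf.
  have ih2 : leb.-integrable setT 
    (EFin \o (fun x => s ^- 2 * (x * sin (t' * x + th) * normal_pdf 0 s x))).
    by apply: (@integrable_EFinZ _ _ _ leb) => //; exact: isin.
  have H_le x : `|x| * `|H x| <= (2 * `|s|) * normal_peak (2 * s).
    rewrite -normrM (le_trans (_ : _ <= `|x * normal_pdf 0 s x|))//.
      by have := xq_le t' x; rewrite normrN mulrA.
    rewrite (le_trans (normr_normal_pdf_le x s0))//.
    rewrite ler_wpM2l ?mulr_ge0//; apply: normal_pdf_ub.
    by rewrite mulf_neq0.
  have H_cvg (u : nat -> R) : (forall n, `|u n| = n.+1%:R) -> H (u n) @[n --> \oo] --> 0.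
    move=> un; apply: norm_cvg0; apply: (@squeeze_cvgr _ _ _ _ (cst 0)
      (fun n => (2 * `|s|) * normal_peak (2 * s) * n.+1%:R^-1)).
    - near=> n; rewrite normr_ge0/= ler_pdivlMr// mulrC.
      by have := H_le (u n); rewrite un.
    - exact: cvg_cst.
    - rewrite -[X in _ --> X](mulr0 ((2 * `|s|) * normal_peak (2 * s))).
      by apply: cvgM; [exact: cvg_cst|exact: cvg_harmonic].
  have ch : continuous h.
    have cq := @continuous_normal_pdf R 0 s s0.
    have ca x : {for x, continuous (fun x => t' * x + th)}.
      apply: cvgD; last exact: cvg_cst.
      by apply: cvgM; [exact: cvg_cst|exact: cvg_id].
    move=> x; apply: cvgB; (apply: cvgM; first exact: cvg_cst).
      by apply: cvgM; [apply: (continuous_comp (ca x)); exact: continuous_cos|exact: cq].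
    apply: cvgM; last exact: cq.
    by apply: cvgM; [exact: cvg_id|apply: (continuous_comp (ca x)); exact: continuous_sin].
  have ih : leb.-integrable setT (EFin \o h).
    by apply: (@integrable_EFinB _ _ _ leb).
  have := Rintegral_derive0 dH ch ih (H_cvg (fun n => n.+1%:R) (fun n => ger0_norm (ler0n _ _))).
  move=> /(_ (H_cvg (fun n => - n.+1%:R) _)); rewrite /h RintegralB// !RintegralZl//.
  rewrite -/(G t') => /(_ _)/eqP; rewrite subr_eq0 => E.
  rewrite -mulrA (eqP (E _)) ?mulrA ?mulfV ?mul1r ?expf_neq0//.
  by move=> n; rewrite normrN ger0_norm.
have dK t' : is_derive t' 1 (fun t' => G t' * expR ((s * t') ^+ 2 / 2)) 0.
  have := dG t'; rewrite [X in is_derive _ _ _ X -> _](_ : _ = - (s ^+ 2 * t' * G t')); last first.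
    rewrite -parts -[in RHS]mulN1r -RintegralZl//.
    by apply: eq_Rintegral => x _; rewrite mulN1r.
  by move=> dGt; apply: is_derive_eq; rewrite /GRing.scale /=; field.
have := is_derive_0_is_cst t 0 dK.
rewrite mulr0 expr0n mul0r expR0 mulr1 => E.
rewrite -/(G t); have -> : G t = G 0 * expR (- ((s * t) ^+ 2 / 2)).
  by rewrite -E -mulrA -expRD subrr expR0 mulr1.
congr (_ * _); rewrite /G.
under eq_Rintegral do rewrite mul0r add0r.
by rewrite RintegralZl// /Rintegral integral_normal_pdf mulr1.
Unshelve. all: by end_near. Qed.

End gauss_characteristic_function.

(** * Lebesgue measure and Gaussians on R^n *)

Section lebesgue_rV_theory.
Context {R : realType}.
Notation leb := (@lebesgue_measure R).
Local Open Scope ereal_scope.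

Lemma ge0_integral_lebesgue_rVS n (f : 'rV[R]_n.+1 -> \bar R) :
  measurable_fun setT f -> (forall x, 0 <= f x) ->
  \int[lebesgue_rV n.+1]_x f x =
  \int[leb]_x \int[lebesgue_rV n]_y f (row_cons (x, y)).
Proof.
move=> mf f0 /=; rewrite /lebesgue_step.
rewrite (ge0_integral_pushforward (@measurable_row_cons R n)) //.
rewrite preimage_setT fubini_tonelli1//.
  by apply: measurableT_comp => //; exact: measurable_row_cons.
by move=> x; exact: f0.
Qed.

Lemma integral_lebesgue_rVS n (f : 'rV[R]_n.+1 -> R) (F : R -> R) :
  (lebesgue_rV n.+1).-integrable setT (EFin \o f) ->
  (forall x, \int[lebesgue_rV n]_y (f (row_cons (x, y)))%:E = (F x)%:E) ->
  \int[lebesgue_rV n.+1]_x (f x)%:E = \int[leb]_x (F x)%:E.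
Proof.
move=> intf fF.
have mf : measurable_fun setT (EFin \o f) := measurable_int _ intf.
have mfc : measurable_fun setT ((EFin \o f) \o @row_cons R n).
  by apply: measurableT_comp => //; exact: measurable_row_cons.
have intfc : (leb \x lebesgue_rV n).-integrable setT ((EFin \o f) \o @row_cons R n).
  apply/integrableP; split => //.
  move/integrableP : intf => [_]; apply: le_lt_trans.
  rewrite /= /lebesgue_step (ge0_integral_pushforward (@measurable_row_cons R n)) //.
  exact: (measurableT_comp (@abse_measurable _ setT) mf).
rewrite /= /lebesgue_step (integral_pushforward (@measurable_row_cons R n)) //.
rewrite preimage_setT -integral12_prod_meas1//.
by apply: eq_integral => x _; rewrite /fubini_F /= fF.
Qed.

Lemma measurable_rV_addr n (v : 'rV[R]_n) :
  measurable_fun setT (fun x : 'rV[R]_n => x + v)%R.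
Proof.
apply: measurable_fun_rV => i.
under eq_fun do rewrite mxE.
by apply: measurable_funD => //; exact: measurable_coord.
Qed.

Lemma lebesgue_measure_addr (v : R) (A : set (measurableTypeR R)) : measurable A ->
  pushforward leb ((fun x => x + v)%R : _ -> measurableTypeR R) A = leb A.
Proof.
move=> mA; apply/esym/lebesgue_measure_unique => //=.
  by apply: measurable_funD.
move=> ? _ [[a b]] _ <-.
rewrite /pushforward.
rewrite (_ : _ @^-1` _ = `](a - v)%R, (b - v)%R]%classic); last first.
  by apply/seteqP; split => x /=; rewrite !in_itv/= ltrBlDr lerBrDr.
rewrite !lebesgue_measure_itv/= !lte_fin ltrD2r.
by case: ifP => // _; rewrite -!EFinB; congr EFin; ring.
Qed.

Lemma ge0_integral_lebesgue_addr (v : R) (f : R -> \bar R) :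
  measurable_fun setT f -> (forall x, 0 <= f x) ->
  \int[leb]_x f (x + v)%R = \int[leb]_x f x.
Proof.
move=> mf f0.
have ma : measurable_fun [set: measurableTypeR R]
    ((fun x => x + v)%R : measurableTypeR R -> measurableTypeR R).
  exact: measurable_funD.
transitivity (\int[pushforward leb ((fun x => x + v)%R : _ -> measurableTypeR R)]_x f x).
  by have := ge0_integral_pushforward ma leb measurableT mf (fun y _ => f0 y).
by apply: eq_measure_integral => A mA _; exact: lebesgue_measure_addr.
Qed.

(** By Tonelli one coordinate splits off: it is moved by the invariance of the one-dimensional
    measure, and the others by induction. *)
Lemma ge0_integral_lebesgue_rV_addr n (v : 'rV[R]_n) (f : 'rV[R]_n -> \bar R) :
  measurable_fun setT f -> (forall x, 0 <= f x) ->
  \int[lebesgue_rV n]_x f (x + v)%R = \int[lebesgue_rV n]_x f x.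
Proof.
elim: n v f => [|n IH] v f mf f0.
  by apply: eq_integral => x _; congr f; apply/rowP => -[].
have mfv : measurable_fun [set: 'rV[R]_n.+1] (fun x : 'rV[R]_n.+1 => f (x + v)%R).
  by apply: measurableT_comp => //; exact: measurable_rV_addr.
rewrite !ge0_integral_lebesgue_rVS//.
pose w : 'rV[R]_n := (\row_j v ord0 (lift ord0 j))%R.
have E (x : R) y : (row_cons (x, y) + v = row_cons ((x + v ord0 ord0)%R, (y + w)%R))%R.
  apply/rowP => i; rewrite mxE; case: (unliftP ord0 i) => [j ->|->].
    by rewrite !row_consS !mxE.
  by rewrite !row_cons0.
have mfc x : measurable_fun setT (fun y => f (row_cons (x, y))).
  apply: (measurableT_comp mf); apply: (measurableT_comp (@measurable_row_cons R n)).
  exact: measurable_pair1.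
under eq_integral => x _.
  under eq_integral do rewrite E.
  rewrite (IH w (fun y => f (row_cons ((x + v ord0 ord0)%R, y))))//.
  over.
rewrite (ge0_integral_lebesgue_addr _ (f := fun x => \int[lebesgue_rV n]_y f (row_cons (x, y))))//.
  apply: (measurable_fun_fubini_tonelli_F (fun p => f (row_cons p))) => //.
  by apply: measurableT_comp => //; exact: measurable_row_cons.
by move=> x; exact: integral_ge0.
Qed.

Lemma integral_lebesgue_rV_addr n (v : 'rV[R]_n) (f : 'rV[R]_n -> \bar R) :
  measurable_fun setT f ->
  \int[lebesgue_rV n]_x f (x + v)%R = \int[lebesgue_rV n]_x f x.
Proof.
move=> mf; rewrite [LHS]integralE [RHS]integralE.
rewrite -(ge0_integral_lebesgue_rV_addr v (measurable_funepos mf)); last first.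
  by move=> x; exact: funepos_ge0.
rewrite -(ge0_integral_lebesgue_rV_addr v (measurable_funeneg mf))//.
by congr (_ - _); apply: eq_integral => x _; rewrite ?funeposE ?funenegE.
Qed.

Lemma integrable_lebesgue_rV_addr n (v : 'rV[R]_n) (f : 'rV[R]_n -> \bar R) :
  (lebesgue_rV n).-integrable setT f ->
  (lebesgue_rV n).-integrable setT (fun x => f (x + v)%R).
Proof.
move=> /integrableP[mf intf]; apply/integrableP; split.
  by apply: measurableT_comp => //; exact: measurable_rV_addr.
rewrite (ge0_integral_lebesgue_rV_addr v (f := fun x => `|f x|))//.
exact: measurableT_comp.
Qed.

End lebesgue_rV_theory.

(** * Product Gaussians and their cosine transforms *)

Section gaussian_rV.
Context {R : realType}.
Implicit Types s th : R.

Definition gaussian_rV n (m : 'rV[R]_n) s (x : 'rV[R]_n) : R :=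
  \prod_(i < n) normal_pdf (m 0 i) s (x 0 i).

Lemma gaussian_rV_ge0 n (m : 'rV[R]_n) s x : 0 <= gaussian_rV m s x.
Proof. by apply: prodr_ge0 => i _; exact: normal_pdf_ge0. Qed.

Lemma measurable_gaussian_rV n (m : 'rV[R]_n) s : measurable_fun setT (gaussian_rV m s).
Proof.
apply: measurable_prod => i _.
by apply: measurableT_comp (measurable_coord i); exact: measurable_normal_pdf.
Qed.

Lemma gaussian_rV_cons n (m : 'rV[R]_n.+1) s x (y : 'rV[R]_n) :
  gaussian_rV m s (row_cons (x, y)) =
  normal_pdf (m 0 ord0) s x * gaussian_rV (\row_j m 0 (lift ord0 j)) s y.
Proof.
rewrite /gaussian_rV big_ord_recl row_cons0; congr (_ * _).
by apply: eq_bigr => i _; rewrite row_consS mxE.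
Qed.

Lemma integral_gaussian_rV n (m : 'rV[R]_n) s :
  (\int[lebesgue_rV n]_x (gaussian_rV m s x)%:E = 1)%E.
Proof.
elim: n m => [|n IH] m.
  rewrite /gaussian_rV; under eq_integral do rewrite big_ord0.
  by rewrite integral_cst//= mul1e diracT.
rewrite ge0_integral_lebesgue_rVS; last 2 first.
- by apply/measurable_EFinP; exact: measurable_gaussian_rV.
- by move=> x; rewrite lee_fin gaussian_rV_ge0.
under eq_integral => x _.
  under eq_integral do rewrite gaussian_rV_cons EFinM.
  rewrite ge0_integralZl_EFin//; last 3 first.
  - by move=> y _; rewrite lee_fin gaussian_rV_ge0.
  - by apply/measurable_EFinP; exact: measurable_gaussian_rV.
  - exact: normal_pdf_ge0.
  rewrite IH mule1.
  over.
exact: integral_normal_pdf.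
Qed.

Lemma integrable_gaussian_rV n (m : 'rV[R]_n) s :
  (lebesgue_rV n).-integrable setT (EFin \o gaussian_rV m s).
Proof.
apply/integrableP; split.
  by apply/measurable_EFinP; exact: measurable_gaussian_rV.
under eq_integral do rewrite /= ger0_norm ?gaussian_rV_ge0//.
by rewrite integral_gaussian_rV ltry.
Qed.

Lemma measurable_dotr n (z : 'rV[R]_n) : measurable_fun setT (dotr z).
Proof.
by apply: measurable_sum => i; apply: measurable_funM => //; exact: measurable_coord.
Qed.

Lemma measurable_cos_dotr n (z : 'rV[R]_n) th :
  measurable_fun setT (fun x => cos (dotr z x + th)).
Proof.
apply: measurableT_comp; first by apply: continuous_measurable_fun; exact: continuous_cos.
by apply: measurable_funD => //; exact: measurable_dotr.
Qed.

Lemma normr_cos_le1 th : `|cos th| <= 1.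
Proof. by rewrite ler_norml cos_geN1 cos_le1. Qed.

Lemma integrable_cosM n (f : 'rV[R]_n -> R) z th :
  (lebesgue_rV n).-integrable setT (EFin \o f) ->
  (lebesgue_rV n).-integrable setT (EFin \o (fun x => cos (dotr z x + th) * f x)).
Proof.
move=> intf; apply: (@le_integrable_EFin _ _ _ _ _ _ (fun x => `|f x|)) => //.
- apply: measurable_funM; first exact: measurable_cos_dotr.
  exact: integrable_EFin_measurable intf.
- exact: integrable_norm.
- by move=> x _; rewrite normrM ler_piMl// normr_cos_le1.
Qed.

(** The arbitrary phase carries the induction: for a fixed first coordinate x, the summand
    [z 0 ord0 * x] is absorbed into the phase of the inner integral. *)
Lemma Rintegral_cos_gaussian_rV n (z : 'rV[R]_n) s th : s != 0 ->
  \int[lebesgue_rV n]_x (cos (dotr z x + th) * gaussian_rV 0 s x) =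
  cos th * \prod_(i < n) expR (- ((s * z 0 i) ^+ 2 / 2)).
Proof.
move=> s0; suff E : (\int[lebesgue_rV n]_x (cos (dotr z x + th) * gaussian_rV 0 s x)%:E =
    (cos th * \prod_(i < n) expR (- ((s * z ord0 i) ^+ 2 / 2)))%:E)%E by rewrite /Rintegral E.
elim: n z th => [|n IH] z th.
  under eq_integral do rewrite /gaussian_rV big_ord0 mulr1 /dotr big_ord0 add0r.
  by rewrite integral_cst//= diracT mule1 big_ord0 mulr1.
pose w : 'rV[R]_n := \row_j z 0 (lift ord0 j).
pose c := \prod_(i < n) expR (- ((s * w 0 i) ^+ 2 / 2)).
rewrite (@integral_lebesgue_rVS _ _ _
    (fun x => c * (cos (z 0 ord0 * x + th) * normal_pdf 0 s x))).
- transitivity (c * (\int[lebesgue_measure]_x (cos (z 0 ord0 * x + th) * normal_pdf 0 s x)))%:E.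
    rewrite -(@RintegralZl _ _ _ lebesgue_measure)//; last exact: integrable_cos_normal_pdf.
    rewrite (@EFin_Rintegral _ _ _ lebesgue_measure)//.
    by apply: (@integrable_EFinZ _ _ _ lebesgue_measure) => //; exact: integrable_cos_normal_pdf.
  rewrite Rintegral_cos_normal_pdf// big_ord_recl; congr EFin.
  rewrite [RHS]mulrA mulrC; congr (_ * _).
  by apply: eq_bigr => i _; rewrite mxE.
- exact/integrable_cosM/integrable_gaussian_rV.
- move=> x.
  have E (y : 'rV[R]_n) : cos (dotr z (row_cons (x, y)) + th) * gaussian_rV 0 s (row_cons (x, y)) =
      normal_pdf 0 s x * (cos (dotr w y + (z 0 ord0 * x + th)) * gaussian_rV 0 s y).
    rewrite gaussian_rV_cons mxE (_ : (\row_j _) = 0); last by apply/rowP => j; rewrite !mxE.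
    rewrite (_ : dotr z _ = z 0 ord0 * x + dotr w y); last first.
      rewrite /dotr big_ord_recl row_cons0; congr (_ + _).
      by apply: eq_bigr => i _; rewrite row_consS mxE.
    by rewrite mulrCA addrCA addrA.
  under eq_integral do rewrite E EFinM.
  rewrite integralZl//; last exact/integrable_cosM/integrable_gaussian_rV.
  by rewrite IH -EFinM; congr EFin; rewrite -/c; ring.
Qed.

End gaussian_rV.

(** * Fourier inversion *)

Section cosine_transform.
Context {R : realType} {n : nat}.
Notation leb := (@lebesgue_rV R n).
Implicit Types (u a : 'rV[R]_n -> R) (x xi : 'rV[R]_n) (th : R).

(* The Fourier transform of a real function [a] at [x] is
   [ctrans a 0 x + i ctrans a (pi / 2) x]. *)
Definition ctrans a th x : R := \int[leb]_xi (cos (dotr x xi + th) * a xi).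

Lemma normr_ctrans_le a th x : leb.-integrable setT (EFin \o a) ->
  `|ctrans a th x| <= \int[leb]_xi `|a xi|.
Proof.
move=> ia; apply: le_normr_RintegralW => //.
- exact: integrable_EFin_measurable (integrable_cosM _ _ ia).
- exact: integrable_norm.
- by move=> y _; rewrite normrM ler_piMl// normr_cos_le1.
Qed.

Lemma ctransE a th x : leb.-integrable setT (EFin \o a) ->
  (\int[leb]_xi (cos (dotr x xi + th) * a xi)%:E = (ctrans a th x)%:E)%E.
Proof. by move=> ia; rewrite /ctrans EFin_Rintegral//; exact: integrable_cosM. Qed.

Lemma ctransD a b th x : leb.-integrable setT (EFin \o a) ->
  leb.-integrable setT (EFin \o b) ->
  ctrans (fun xi => a xi + b xi) th x = ctrans a th x + ctrans b th x.
Proof.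
move=> ia ib; rewrite /ctrans -RintegralD//; try exact: integrable_cosM.
by apply: eq_Rintegral => xi _; rewrite mulrDr.
Qed.

Lemma ctransZ k a th x : leb.-integrable setT (EFin \o a) ->
  ctrans (fun xi => k * a xi) th x = k * ctrans a th x.
Proof.
move=> ia; rewrite /ctrans -RintegralZl//; try exact: integrable_cosM.
by apply: eq_Rintegral => xi _; rewrite mulrCA.
Qed.

Lemma ctrans_phase a th x : leb.-integrable setT (EFin \o a) ->
  ctrans a th x = cos th * ctrans a 0 x + sin th * ctrans a (pi / 2) x.
Proof.
move=> ia; rewrite /ctrans -!RintegralZl -?RintegralD//;
  do ?[apply: integrable_EFinZ => //]; try exact: integrable_cosM.
apply: eq_Rintegral => xi _; rewrite addr0 !cosD cos_pihalf sin_pihalf.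
by ring.
Qed.

End cosine_transform.

Section product_integrable.
Context d1 d2 (T1 : measurableType d1) (T2 : measurableType d2) (R : realType).
Context (m1 : {sigma_finite_measure set T1 -> \bar R})
  (m2 : {sigma_finite_measure set T2 -> \bar R}).

Lemma integrable_prod_mul (f : T1 -> R) (g : T2 -> R) :
  m1.-integrable setT (EFin \o f) -> m2.-integrable setT (EFin \o g) ->
  (m1 \x m2)%E.-integrable setT (EFin \o (fun p => f p.1 * g p.2)).
Proof.
move=> intf intg.
have mf := integrable_EFin_measurable intf.
have mg := integrable_EFin_measurable intg.
apply/integrable12ltyP.
  apply/measurable_EFinP; apply: measurable_funM.
    exact: (measurableT_comp mf measurable_fst).
  exact: (measurableT_comp mg measurable_snd).
have Ng : (\int[m2]_y `|g y|%:E)%E = (\int[m2]_y `|g y|)%:E.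
  by rewrite EFin_Rintegral//; exact: integrable_norm.
under eq_integral => x _.
  under eq_integral do rewrite /= normrM EFinM.
  rewrite ge0_integralZl_EFin//; last first.
    by apply/measurable_EFinP; exact: measurableT_comp.
  rewrite Ng muleC.
  over.
rewrite ge0_integralZl_EFin//; last 2 first.
- by apply/measurable_EFinP; exact: measurableT_comp.
- exact: Rintegral_ge0.
rewrite -(@EFin_Rintegral _ _ _ m1 _ (fun x => `|f x|))// ?ltry//.
exact: integrable_norm.
Qed.

End product_integrable.

(** * Gaussian summation *)

Section gaussian_summation.
Context {R : realType} {n : nat}.
Notation leb := (@lebesgue_rV R n).
Implicit Types (u q : 'rV[R]_n -> R) (x y xi : 'rV[R]_n).

Lemma dotrC x y : dotr x y = dotr y x.
Proof. by apply: eq_bigr => i _; rewrite mulrC. Qed.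

Lemma dotrBl x y xi : dotr (x - y) xi = dotr x xi - dotr y xi.
Proof. by rewrite /dotr -sumrB; apply: eq_bigr => i _; rewrite !mxE mulrBl. Qed.

Lemma dotrDl x y xi : dotr (x + y) xi = dotr x xi + dotr y xi.
Proof. by rewrite /dotr -big_split; apply: eq_bigr => i _; rewrite !mxE mulrDl. Qed.

Lemma dotrZl k x xi : dotr (k *: x) xi = k * dotr x xi.
Proof. by rewrite /dotr mulr_sumr; apply: eq_bigr => i _; rewrite !mxE mulrA. Qed.

Lemma measurable_dotr2 :
  measurable_fun setT (fun p : 'rV[R]_n * 'rV[R]_n => dotr p.1 p.2).
Proof.
apply: measurable_sum => i; apply: measurable_funM.
  exact: (measurableT_comp (measurable_coord i) measurable_fst).
exact: (measurableT_comp (measurable_coord i) measurable_snd).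
Qed.

(** The phase may depend on the frequency [p.1]: the choice [- dotr x p.1] will centre the kernel at
    x. The weight [q] is what makes the product integrable, so that Fubini applies. *)
Lemma integrable_cos_kernel q u (phi : 'rV[R]_n -> R) :
  leb.-integrable setT (EFin \o q) -> leb.-integrable setT (EFin \o u) ->
  measurable_fun setT phi ->
  (leb \x leb)%E.-integrable setT
    (EFin \o (fun p => q p.1 * (cos (dotr p.1 p.2 + phi p.1) * u p.2))).
Proof.
move=> iq iu mphi.
have iqu := integrable_prod_mul iq iu.
apply: (le_integrable_EFin measurableT _ (integrable_norm iqu)).
  apply: measurable_funM.
    exact: (measurableT_comp (integrable_EFin_measurable iq) measurable_fst).
  apply: measurable_funM.
    apply: measurableT_comp.
      by apply: continuous_measurable_fun; exact: continuous_cos.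
    apply: measurable_funD; first exact: measurable_dotr2.
    exact: (measurableT_comp mphi measurable_fst).
  exact: (measurableT_comp (integrable_EFin_measurable iu) measurable_snd).
move=> p _; rewrite /= !normrM ler_wpM2l// ler_piMl//.
exact: normr_cos_le1.
Qed.

Lemma gaussian_rV_gt0 (m : 'rV[R]_n) s x : s != 0 -> 0 < gaussian_rV m s x.
Proof.
move=> s0; apply: prodr_gt0 => i _; rewrite normal_pdfE// mulr_gt0//.
  exact: normal_peak_gt0.
exact: expR_gt0.
Qed.

(** The kernel alone need not be integrable on the product space. A positive integrable Gaussian
    weight makes Fubini give measurability, and is then divided out. *)
Lemma measurable_ctrans u (phi : 'rV[R]_n -> R) :
  leb.-integrable setT (EFin \o u) -> measurable_fun setT phi ->
  measurable_fun setT (fun xi => ctrans u (phi xi) xi).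
Proof.
move=> iu mphi; pose q := gaussian_rV (0 : 'rV[R]_n) 1.
have q0 xi : 0 < q xi by exact: gaussian_rV_gt0.
have := measurable_fubini_F (integrable_cos_kernel (integrable_gaussian_rV 0 1) iu mphi).
rewrite -/q /fubini_F /= => mF.
have {mF} : measurable_fun setT (fun xi => q xi * ctrans u (phi xi) xi).
  apply/measurable_EFinP; apply: eq_measurable_fun mF => xi _.
  by under eq_integral do rewrite EFinM; rewrite integralZl ?ctransE//; exact: integrable_cosM.
move=> mF.
(* Division by [q] is written [expR (- ln (q xi))], a composition of functions known to be
   measurable. *)
have -> : (fun xi => ctrans u (phi xi) xi) =
    (fun xi => expR (- ln (q xi)) * (q xi * ctrans u (phi xi) xi)).
  by apply/funext => xi; rewrite expRN lnK ?posrE// mulKf// gt_eqF.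
apply: measurable_funM => //; apply: measurableT_comp => //.
apply: measurableT_comp => //; apply: measurableT_comp => //.
exact: measurable_gaussian_rV.
Qed.

(** The multiplication formula: Fubini moves the transform from [u] to the Gaussian, whose transform
    is explicit. *)
Lemma Rintegral_gaussian_ctrans u s x : s != 0 -> leb.-integrable setT (EFin \o u) ->
  \int[leb]_xi (gaussian_rV 0 s xi * ctrans u (- dotr x xi) xi) =
  \int[leb]_y (u y * \prod_(i < n) expR (- ((s * (y - x) 0 i) ^+ 2 / 2))).
Proof.
move=> s0 iu.
have mphi : measurable_fun setT (fun xi => - dotr x xi).
  by apply: measurableT_comp => //; exact: measurable_dotr.
have ig := @integrable_gaussian_rV R n 0 s.
have := Fubini (integrable_cos_kernel ig iu mphi).
rewrite /= => FE; congr fine.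
transitivity (\int[leb]_xi \int[leb]_y
    (gaussian_rV 0 s xi * (cos (dotr xi y + - dotr x xi) * u y))%:E)%E.
  apply: eq_integral => xi _.
  by under [RHS]eq_integral do rewrite EFinM; rewrite integralZl ?ctransE//; exact: integrable_cosM.
rewrite FE; apply: eq_integral => y _.
have E xi : gaussian_rV 0 s xi * (cos (dotr xi y + - dotr x xi) * u y) =
    u y * (cos (dotr (y - x) xi + 0) * gaussian_rV 0 s xi).
  by rewrite addr0 dotrBl (dotrC xi) mulrA mulrC [gaussian_rV _ _ _ * _]mulrC.
under eq_integral do rewrite E EFinM.
rewrite integralZl//; last exact: integrable_cosM.
by rewrite ctransE// -EFinM /ctrans Rintegral_cos_gaussian_rV// cos0 mul1r.
Qed.

End gaussian_summation.

Section fourier_inversion.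
Context {R : realType} {n : nat}.
Notation leb := (@lebesgue_rV R n).
Implicit Types (u : 'rV[R]_n -> R) (x y xi : 'rV[R]_n).

Lemma normal_peakE (s : R) : normal_peak s = normal_peak 1 / `|s|.
Proof.
rewrite /normal_peak expr1n mul1r -mulrnAr sqrtrM ?sqr_ge0// sqrtr_sqr invfM.
by rewrite mulrC.
Qed.

Lemma gaussian_rV_ub (m : 'rV[R]_n) s x : s != 0 -> gaussian_rV m s x <= normal_peak s ^+ n.
Proof.
move=> s0; rewrite -[X in _ ^+ X]card_ord -prodr_const; apply: ler_prod => i _.
by rewrite normal_pdf_ge0 normal_pdf_ub.
Qed.

(** Doubling all widths costs 2^n. Of the n decaying factors so produced only that of coordinate [i]
    is kept, the others being at most 1. *)
Lemma gaussian_rV_tail (m : 'rV[R]_n) s x i : s != 0 ->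
  gaussian_rV m s x <=
  2 ^+ n * expR (- (3 / 8 * ((x 0 i - m 0 i) / s) ^+ 2)) * gaussian_rV m (2 * s) x.
Proof.
move=> s0; rewrite /gaussian_rV.
under eq_bigr do rewrite normal_pdf2//.
rewrite big_split big_split/= prodr_const card_ord.
rewrite [leRHS]mulrAC ler_wpM2l//.
  rewrite mulr_ge0 ?exprn_ge0//; apply: prodr_ge0 => j _; exact: normal_pdf_ge0.
rewrite (bigD1 i)//= ler_piMr ?expR_ge0//.
apply: prodr_ile1 => j _; rewrite expR_ge0/= -expR0 ler_expR oppr_le0.
by rewrite mulr_ge0// sqr_ge0.
Qed.

(** On the ball the oscillation bound applies. Off it, some coordinate is at distance at least r and
    the tail factor appears; it is paired with the supremum of the wider Gaussian for [u y], where u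
    will only be integrable, and with the wider Gaussian itself for the constant [u x]. *)
Lemma gaussian_rV_diff_le u x y (e r s : R) : 0 < r -> s != 0 ->
  (forall y, ball x r y -> `|u y - u x| <= e) -> 0 <= e ->
  `|(u y - u x) * gaussian_rV x s y| <= e * gaussian_rV x s y +
    (2 ^+ n * expR (- (3 / 8 * (r / s) ^+ 2))) *
    (normal_peak (2 * s) ^+ n * `|u y| + `|u x| * gaussian_rV x (2 * s) y).
Proof.
move=> r0 s0 xr e0; rewrite normrM (ger0_norm (gaussian_rV_ge0 _ _ _)).
have [xy|] := pselect (ball x r y).
  rewrite ler_wpDr//.
    rewrite mulr_ge0 ?mulr_ge0 ?exprn_ge0 ?expR_ge0// addr_ge0 ?mulr_ge0//.
      by rewrite exprn_ge0// normal_peak_ge0.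
    exact: gaussian_rV_ge0.
  by rewrite ler_wpM2r ?gaussian_rV_ge0// xr.
move=> xy.
have [i ri] : exists i, r <= `|y 0 i - x 0 i|.
  apply: contrapT => /forallNP H; apply: xy; split=> // j i.
  by rewrite /ball/= (ord1 j) distrC ltNge; apply/negP; exact: H.
rewrite ler_wpDl ?mulr_ge0 ?gaussian_rV_ge0//.
have s20 : 2 * s != 0 by rewrite mulf_neq0.
set E := 2 ^+ n * _.
have GE : gaussian_rV x s y <= E * gaussian_rV x (2 * s) y.
  apply: (le_trans (gaussian_rV_tail _ _ i s0)).
  rewrite ler_wpM2r ?gaussian_rV_ge0// ler_wpM2l ?exprn_ge0// ler_expR lerN2.
  rewrite ler_wpM2l ?divr_ge0// !expr_div_n ler_wpM2r ?invr_ge0 ?sqr_ge0//.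
  by rewrite -[leRHS]real_normK ?num_real// lerXn2r ?nnegrE// ltW.
apply: (@le_trans _ _ ((`|u y| + `|u x|) * (E * gaussian_rV x (2 * s) y))).
  by rewrite ler_pM ?gaussian_rV_ge0// ler_normB.
rewrite mulrCA ler_wpM2l ?mulr_ge0 ?exprn_ge0 ?expR_ge0//.
rewrite mulrDl lerD2r mulrC ler_wpM2r//.
exact: gaussian_rV_ub.
Qed.

(** With m = k + 1 and z = K m^2, the bound exp z >= z^(n+1) / (n+1)! makes the product at most C
    m^(n - 2n - 2) <= C / m. The power m^n is the growth of the height of a Gaussian of width 1 /
    m. *)
Lemma expR_sqr_decay (K : R) : 0 < K ->
  expR (- (K * k.+1%:R ^+ 2)) * k.+1%:R ^+ n @[k --> \oo] --> (0 : R).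
Proof.
move=> K0; pose C := (n.+1)`!%:R / K ^+ n.+1.
apply: (@squeeze_cvgr _ _ _ _ (cst 0) (fun k => C * k.+1%:R^-1)).
- near=> k; rewrite mulr_ge0 ?expR_ge0//=.
  have k0 : 0 < k.+1%:R :> R by [].
  have z0 : 0 < K * k.+1%:R ^+ 2 by rewrite mulr_gt0// exprn_gt0.
  rewrite expRN mulrC ler_pdivrMr ?expR_gt0//.
  have := expR_ge1Dxn n (ltW z0).
  set z := K * _ => H.
  have {}H : z ^+ n.+1 / (n.+1)`!%:R <= expR z.
    by apply: le_trans H; rewrite lerDr.
  apply: (@le_trans _ _ (C / k.+1%:R * (z ^+ n.+1 / (n.+1)`!%:R))); last first.
    by rewrite ler_wpM2l// !divr_ge0 ?exprn_ge0// ltW.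
  rewrite [leRHS](_ : _ = k.+1%:R ^+ (n.+1).*2 / k.+1%:R); last first.
    rewrite /C /z exprMn -exprM mul2n.
    by field; rewrite pnatr_eq0 -lt0n fact_gt0 expf_neq0 ?gt_eqF.
  rewrite ler_pdivlMr// -exprSr ler_weXn2l ?ler1n//.
  by rewrite -addnn leq_addr.
- exact: cvg_cst.
- rewrite -[X in _ --> X](mulr0 C).
  by apply: cvgM; [exact: cvg_cst|exact: cvg_harmonic].
Unshelve. all: by end_near. Qed.

Lemma integrable_gaussian_rVM u x s : s != 0 -> leb.-integrable setT (EFin \o u) ->
  leb.-integrable setT (EFin \o (fun y => u y * gaussian_rV x s y)).
Proof.
move=> s0 iu.
apply: (@le_integrable_EFin _ _ _ _ _ _ (fun y => normal_peak s ^+ n * `|u y|)) => //.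
- apply: measurable_funM; first exact: integrable_EFin_measurable iu.
  exact: measurable_gaussian_rV.
- by apply: integrable_EFinZ => //; exact: integrable_norm.
- move=> y _; rewrite normrM mulrC (ger0_norm (gaussian_rV_ge0 _ _ _)).
  by rewrite ler_wpM2r// gaussian_rV_ub.
Qed.

Lemma gaussian_rV_approx u x : leb.-integrable setT (EFin \o u) ->
  {for x, continuous u} ->
  \int[leb]_y (u y * gaussian_rV x (k.+1%:R^-1) y) @[k --> \oo] --> u x.
Proof.
move=> iu cu; apply/cvgrPdist_le => e e0.
have e20 : 0 < e / 2 by rewrite divr_gt0.
have [r /= r0 xr] : exists2 r : R, 0 < r & forall y, ball x r y -> `|u y - u x| <= e / 2.
  move/cvgrPdist_le : cu => /(_ _ e20)/nbhs_ballP[r r0 xr].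
  by exists r => // y xy; rewrite distrC; exact: xr.
(* What remains of the tail after the power k.+1^n is taken out of the peak of the Gaussian of width
   2 / k.+1. Below, [D + 1] keeps the divisor positive. *)
pose D := (normal_peak 1 / 2) ^+ n * (\int[leb]_y `|u y|) + `|u x|.
have D0 : 0 <= D.
  by rewrite addr_ge0// mulr_ge0 ?Rintegral_ge0// exprn_ge0// divr_ge0// normal_peak_ge0.
have K0 : 0 < 3 / 8 * r ^+ 2 by rewrite mulr_gt0// exprn_gt0.
have /cvgrPdist_le H := expR_sqr_decay K0.
have e3 : 0 < e / 2 / (2 ^+ n * (D + 1)).
  by rewrite divr_gt0// mulr_gt0 ?exprn_gt0// ltr_wpDl.
near=> k; have Hk : `|0 - expR (- (3 / 8 * r ^+ 2 * k.+1%:R ^+ 2)) * k.+1%:R ^+ n|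
    <= e / 2 / (2 ^+ n * (D + 1)) by near: k; exact: H.
move: Hk; rewrite sub0r normrN ger0_norm; last by rewrite mulr_ge0 ?expR_ge0.
rewrite ler_pdivlMr ?mulr_gt0 ?exprn_gt0// ?ltr_wpDl// => Hk.
set s : R := k.+1%:R^-1.
have s0 : 0 < s by rewrite invr_gt0.
have sN0 : s != 0 by rewrite gt_eqF.
have s20 : 2 * s != 0 by rewrite mulf_neq0.
have ig t := @integrable_gaussian_rV R n x t.
have Ig t : \int[leb]_y gaussian_rV x t y = 1 by rewrite /Rintegral integral_gaussian_rV.
have -> : u x - \int[leb]_y (u y * gaussian_rV x s y) =
    - \int[leb]_y ((u y - u x) * gaussian_rV x s y).
  under [in RHS]eq_Rintegral do rewrite mulrBl.
  rewrite RintegralB//; last 2 first.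
  - exact: integrable_gaussian_rVM.
  - exact: integrable_EFinZ.
  by rewrite RintegralZl// Ig mulr1 opprB.
rewrite normrN.
set E := 2 ^+ n * expR (- (3 / 8 * (r / s) ^+ 2)).
have in1 : leb.-integrable setT (EFin \o (fun y => normal_peak (2 * s) ^+ n * `|u y|)).
  by apply: integrable_EFinZ => //; exact: integrable_norm.
have in2 : leb.-integrable setT (EFin \o (fun y => `|u x| * gaussian_rV x (2 * s) y)).
  exact: integrable_EFinZ.
have in3 := integrable_EFinD measurableT in1 in2.
have in4 := integrable_EFinZ E measurableT in3.
have in5 := integrable_EFinZ (e / 2) measurableT (ig s).
apply: (@le_trans _ _ (\int[leb]_y (e / 2 * gaussian_rV x s y +
    E * (normal_peak (2 * s) ^+ n * `|u y| + `|u x| * gaussian_rV x (2 * s) y)))).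
  apply: le_normr_RintegralW => //.
  - apply: measurable_funM; last exact: measurable_gaussian_rV.
    by apply: measurable_funB => //; exact: integrable_EFin_measurable iu.
  - exact: integrable_EFinD.
  - by move=> y _; apply: gaussian_rV_diff_le => //; exact: ltW.
rewrite RintegralD// [X in X + _]RintegralZl// Ig mulr1 RintegralZl// RintegralD//.
rewrite [X in _ * (X + _)]RintegralZl//; last exact: integrable_norm.
rewrite RintegralZl// Ig mulr1 [leRHS]splitr lerD2l.
apply: le_trans Hk; rewrite /E.
have -> : r / s = r * k.+1%:R by rewrite invrK.
have -> : normal_peak (2 * s) = normal_peak 1 / 2 * k.+1%:R.
  by rewrite normal_peak2 normal_peakE gtr0_norm// invrK mulrAC.
have m1 : 1 <= k.+1%:R ^+ n :> R by rewrite exprn_ege1// ler1n.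
rewrite [(_ / 2 * _) ^+ n]exprMn [(r * _) ^+ 2]exprMn [3 / 8 * (_ * _)]mulrA /D.
move: m1; set A := expR _; set M := k.+1%:R ^+ n; set P := (normal_peak 1 / 2) ^+ n.
move: (Rintegral _ _ _) => N.
move=> m1.
rewrite [leLHS](_ : _ = 2 ^+ n * A * (P * M * N + `|u x|)); last by ring.
rewrite [leRHS](_ : _ = 2 ^+ n * A * (P * M * N + M * (`|u x| + 1))); last by ring.
rewrite ler_wpM2l ?mulr_ge0 ?exprn_ge0 ?expR_ge0// lerD2l.
have : 0 <= `|u x| by [].
by nra.
Unshelve. all: by end_near. Qed.

Lemma gaussian_rV_dual s x y : 0 < s ->
  \prod_(i < n) expR (- ((s * (y - x) 0 i) ^+ 2 / 2)) =
  normal_peak s^-1 ^- n * gaussian_rV x s^-1 y.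
Proof.
move=> s0; rewrite /gaussian_rV; under [in RHS]eq_bigr do rewrite normal_pdfE ?invr_neq0 ?gt_eqF//.
rewrite big_split/= prodr_const card_ord mulKf; last first.
  by rewrite expf_neq0// gt_eqF// normal_peak_gt0// invr_neq0// gt_eqF.
apply: eq_bigr => i _; rewrite /normal_fun !mxE; congr expR.
rewrite -[X in _ / X]mulr_natr exprVn exprMn mulNr; congr (- _).
by field; rewrite gt_eqF.
Qed.

(* The phase turns [ctrans u (- dotr x xi) xi] into the real part of
   [\hat u(xi) e^{i x.xi}]. *)
Lemma fourier_inversion u x : leb.-integrable setT (EFin \o u) ->
  {for x, continuous u} ->
  leb.-integrable setT (EFin \o (fun xi => ctrans u (- dotr x xi) xi)) ->
  (2 * pi) ^+ n * u x = \int[leb]_xi ctrans u (- dotr x xi) xi.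
Proof.
move=> iu cu iV; set V := fun xi => ctrans u (- dotr x xi) xi.
(* The summation factor: at most 1, tending to 1 with k, and equal to a Gaussian of width k.+1
   rescaled to height 1. The weighted integral is computed in two ways as k grows, by dominated
   convergence and by the approximate identity. *)
pose N (k : nat) xi : R := \prod_(i < n) expR (- ((xi 0 i / k.+1%:R) ^+ 2 / 2)).
have N_le1 k xi : 0 <= N k xi <= 1.
  apply/andP; split; first by apply: prodr_ge0 => i _; exact: expR_ge0.
  apply: prodr_ile1 => i _; rewrite expR_ge0/= -expR0 ler_expR oppr_le0.
  by rewrite divr_ge0// sqr_ge0.
have NE k xi : N k xi = normal_peak k.+1%:R ^- n * gaussian_rV 0 k.+1%:R xi.
  have := @gaussian_rV_dual (k.+1%:R^-1) 0 xi; rewrite invr_gt0 invrK => <- //.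
  by apply: eq_bigr => i _; rewrite subr0 [_^-1 * _]mulrC.
have NV k : \int[leb]_xi (N k xi * V xi) =
    (2 * pi) ^+ n * \int[leb]_y (u y * gaussian_rV x k.+1%:R^-1 y).
  have k0 : 0 < k.+1%:R :> R by [].
  have kN0 : k.+1%:R != 0 :> R by rewrite gt_eqF.
  under eq_Rintegral do rewrite NE -mulrA.
  rewrite RintegralZl//; last first.
    under [X in integrable _ _ (_ \o X)]eq_fun do rewrite mulrC.
    exact: integrable_gaussian_rVM.
  rewrite Rintegral_gaussian_ctrans//.
  under eq_Rintegral do rewrite gaussian_rV_dual// mulrCA.
  rewrite RintegralZl//; last exact: integrable_gaussian_rVM.
  rewrite mulrA; congr (_ * _).
  (* The two widths are reciprocal, so the peaks multiply to [normal_peak 1 ^+ 2], the inverse of 2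
     pi. *)
  rewrite -exprVn -[X in _ * X]exprVn -exprMn; congr (_ ^+ n).
  rewrite (normal_peakE k.+1%:R) (normal_peakE _^-1) !gtr0_norm ?invr_gt0//.
  have p1 : normal_peak (1 : R) ^- 2 = 2 * pi.
    by rewrite /normal_peak exprVn invrK sqr_sqrtr expr1n mul1r ?mulr_natl// mulrn_wge0// pi_ge0.
  rewrite -p1; move: (k.+1%:R : R) kN0 => m m0.
  by field; rewrite m0 gt_eqF ?normal_peak_gt0// oner_neq0.
have cvN : \int[leb]_xi (N k xi * V xi) @[k --> \oo] --> \int[leb]_xi V xi.
  have [||||_] := @dominated_cvg_Rintegral _ _ _ leb setT (fun k xi => N k xi * V xi) V
    (fun xi => `|V xi|) measurableT.
  - move=> k; apply: measurable_funM; last exact: integrable_EFin_measurable iV.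
    rewrite (_ : N k = fun xi => normal_peak k.+1%:R ^- n * gaussian_rV 0 k.+1%:R xi);
      last by apply/funext => xi; exact: NE.
    by apply: measurable_funM => //; exact: measurable_gaussian_rV.
  - exact: integrable_norm.
  - move=> k xi _; have /andP[N0 N1] := N_le1 k xi.
    by rewrite normrM ger0_norm// ler_piMl.
  - move=> xi _; rewrite -[X in _ --> X]mul1r; apply: cvgM; last exact: cvg_cst.
    pose F (t : R) := \prod_(i < n) expR (- ((xi 0 i * t) ^+ 2 / 2)).
    have cF : continuous F.
      apply: continuous_big; first exact: mul_continuous.
      move=> i _ t; apply: continuous_comp; last exact: continuous_expR.
      apply: cvgN; apply: cvgM; last exact: cvg_cst.
      apply: (@continuous_comp _ _ _ (fun t => xi 0 i * t) (fun z => z ^+ 2)).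
        by apply: cvgM; [exact: cvg_cst|exact: cvg_id].
      exact: exprn_continuous.
    have F0 : F 0 = 1.
      by rewrite /F big1// => i _; rewrite mulr0 expr0n/= mul0r oppr0 expR0.
    rewrite -F0; exact: (continuous_cvg _ (cF 0) cvg_harmonic).
  exact.
apply: (cvg_unique (@norm_hausdorff _ R) _ cvN).
rewrite (_ : (fun k => _) = fun k => (2 * pi) ^+ n *
  \int[leb]_y (u y * gaussian_rV x k.+1%:R^-1 y)); last exact/funext.
by apply: cvgM; [exact: cvg_cst|exact: gaussian_rV_approx].
Qed.


End fourier_inversion.

(** * Taylor expansions of the cosine and of the arcsine *)

Section trigonometric_expansions.
Context {R : realType}.
Implicit Types t A : R.

Lemma nneg_of_derive (f df : R -> R) (b : R) : (forall x : R, is_derive x (1 : R) f (df x)) ->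
  f 0 = 0 -> (forall x, 0 <= x <= b -> 0 <= df x) ->
  forall x, 0 <= x <= b -> 0 <= f x.
Proof.
move=> fd f0 df0 x /andP[x0 xb]; move: x0; rewrite le_eqVlt => /predU1P[<-|x0]; first by rewrite f0.
have [|c] := @MVT _ f df 0 x x0 (fun y _ => fd y).
- apply: derivable_within_continuous => y _; exact: (@ex_derive _ _ _ _ _ _ _ (fd y)).
rewrite in_itv/= => /andP[c0 cx]; rewrite f0 !subr0 => ->.
by rewrite mulr_ge0 ?(ltW x0)// df0// (ltW c0)/= (le_trans (ltW cx)).
Qed.

Lemma is_derive_exprS (f : R -> R) (df t : R) n : is_derive t 1 f df ->
  is_derive t 1 (fun t => f t ^+ n.+1) (n.+1%:R * f t ^+ n * df).
Proof.
move=> fd; have := is_deriveX n.+1 fd; rewrite /GRing.scale /=.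
rewrite (_ : f ^+ n.+1 = (fun t => f t ^+ n.+1))//.
apply/funext => x; elim: (n.+1) => // m IH.
by rewrite !exprS -IH.
Qed.

(** The Taylor remainder of the cosine at [A]. The k-th derivative is written as a shift by k
    quarter turns, so that every Taylor term has the form of the kernel of [ctrans]. *)
Definition cos_rem N A t :=
  cos (A + t) - \sum_(k < N) cos (A + k%:R * (pi / 2)) * (t ^+ k / k`!%:R).

Lemma cos_rem0 A t : cos_rem 0 A t = cos (A + t).
Proof. by rewrite /cos_rem big_ord0 subr0. Qed.

Lemma cos_remS N A t : cos_rem N.+1 A t =
  cos_rem N A t - cos (A + N%:R * (pi / 2)) * (t ^+ N / N`!%:R).
Proof. by rewrite /cos_rem big_ord_recr opprD addrA. Qed.

Lemma cosD_pihalf A : cos (A + pi / 2) = - sin A.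
Proof. by rewrite cosD cos_pihalf sin_pihalf mulr0 mulr1 sub0r. Qed.

Lemma is_derive_cos_rem N A t :
  is_derive t 1 (cos_rem N.+1 A) (cos_rem N (A + pi / 2) t).
Proof.
elim: N => [|N IH].
  have -> : cos_rem 1 A = (fun t => cos (A + t) - cos A).
    by apply/funext => x; rewrite cos_remS cos_rem0 mul0r addr0 expr0 fact0 divr1 mulr1.
  rewrite cos_rem0 addrAC cosD_pihalf.
  by apply: is_derive_eq; rewrite /GRing.scale /=; ring.
pose c := cos (A + N.+1%:R * (pi / 2)); pose C := c / (N.+1)`!%:R.
have -> : cos_rem N.+2 A = (fun t => cos_rem N.+1 A t - C * t ^+ N.+1).
  by apply/funext => x; rewrite cos_remS /C /c; ring.
have -> : cos_rem N.+1 (A + pi / 2) t = cos_rem N (A + pi / 2) t - c * (t ^+ N / N`!%:R).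
  rewrite cos_remS /c; congr (_ - cos _ * _).
  by rewrite -natr1; ring.
have f0 : N`!%:R != 0 :> R by rewrite pnatr_eq0 -lt0n fact_gt0.
apply: (is_derive_eq (is_deriveB IH (is_deriveM (is_derive_cst C _ _)
  (is_derive_exprS N (is_derive_id t 1))))).
rewrite /GRing.scale /=; congr (_ - _).
rewrite mulr0 addr0 mulr1 /C factS natrM.
have : N.+1%:R != 0 :> R by rewrite pnatr_eq0.
by move: (N.+1%:R : R) => m m0; field; rewrite f0 m0.
Qed.

Lemma cos_phaseN k A :
  cos (A + k%:R * (pi / 2)) * (-1) ^+ k = cos (- A + k%:R * (pi / 2)).
Proof.
elim: k A => [|k IH] A; first by rewrite mulr1 !mul0r !addr0 cosN.
have -> : A + k.+1%:R * (pi / 2) = (A + pi / 2) + k%:R * (pi / 2) by rewrite -natr1; ring.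
have -> : - A + k.+1%:R * (pi / 2) = - (A + pi / 2) + k%:R * (pi / 2) + pi.
  by rewrite -natr1; field.
by rewrite cosDpi -IH exprS; ring.
Qed.

Lemma cos_remN N A t : cos_rem N A (- t) = cos_rem N (- A) t.
Proof.
rewrite /cos_rem -cosN opprD opprK; congr (_ - _); apply: eq_bigr => k _.
by rewrite -cos_phaseN [(- t) ^+ k]exprNn; ring.
Qed.

(** The remainder of order N + 1 has as derivative the remainder of order N with phase A + pi / 2.
    Comparing derivatives on [0, t] with both signs [e] raises the order by one; parity reduces to t
    >= 0. *)
Lemma normr_cos_rem_le N A t : `|cos_rem N A t| <= `|t| ^+ N / N`!%:R.
Proof.
wlog t0 : A t / 0 <= t.
  move=> H; have [|t0] := leP 0 t; first exact: H.
  rewrite -(opprK t) cos_remN normrN; apply: H.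
  by rewrite oppr_ge0 ltW.
rewrite (ger0_norm t0).
elim: N A t t0 => [|N IH] A t t0.
  by rewrite /cos_rem big_ord0 subr0 expr0 fact0 divr1 normr_cos_le1.
have key (e : R) : `|e| = 1 -> 0 <= t ^+ N.+1 / (N.+1)`!%:R - e * cos_rem N.+1 A t.
  move=> e1.
  pose f x := x ^+ N.+1 / (N.+1)`!%:R - e * cos_rem N.+1 A x.
  pose df x := x ^+ N / N`!%:R - e * cos_rem N (A + pi / 2) x.
  apply: (@nneg_of_derive f df t); last by rewrite t0 lexx.
  - move=> x; rewrite /f /df.
    have d1 := is_derive_cos_rem N A x.
    apply: (is_derive_eq (is_deriveB (is_deriveM (is_derive_exprS N (is_derive_id x 1))
      (is_derive_cst ((N.+1)`!%:R^-1 : R) _ _)) (is_deriveM (is_derive_cst e _ _) d1))).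
    have f0 : N`!%:R != 0 :> R by rewrite pnatr_eq0 -lt0n fact_gt0.
    rewrite /GRing.scale /= !mulr0 addr0 add0r mulr1 factS natrM.
    have : N.+1%:R != 0 :> R by rewrite pnatr_eq0.
    by move: (N.+1%:R : R) => m m0; field; rewrite f0 m0.
  - rewrite /f expr0n mul0r sub0r /cos_rem big_ord_recl big1 ?addr0.
      by rewrite mul0r addr0 expr0 fact0 divr1 mulr1 subrr mulr0 oppr0.
    by move=> i _; rewrite expr0n mul0r mulr0.
  - move=> x /andP[x0 _]; rewrite /df subr_ge0 (le_trans (ler_norm _))// normrM e1 mul1r.
    exact: IH.
rewrite ler_norml; apply/andP; split.
  by have := key (-1); rewrite normrN1 mulN1r opprK => /(_ erefl); rewrite -lerBlDl sub0r.
by have := key 1; rewrite normr1 mul1r => /(_ erefl); rewrite subr_ge0.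
Qed.

Lemma normr_sin_le t : `|sin t| <= `|t|.
Proof.
have := normr_cos_rem_le 1 (- (pi / 2)) t.
rewrite expr1 factS fact0 divr1 /cos_rem big_ord1 mul0r addr0 expr0 divr1 mulr1.
by rewrite cosN cos_pihalf subr0 addrC cosBpihalf.
Qed.

(* [binc k] is [4 ^ - k * 'C(2 k, k)]; the Taylor series of [asin] is
   [\sum_k binc k / (2 k + 1) * y ^ (2 k + 1)]. *)
Definition binc k : R := \prod_(j < k) ((2 * j + 1)%:R / (2 * j + 2)%:R).

Definition asin_coef k : R := binc k / (2 * k + 1)%:R.

Lemma bincS k : binc k.+1 * (2 * k + 2)%:R = binc k * (2 * k + 1)%:R.
Proof. by rewrite /binc big_ord_recr/= -!mulrA mulVf ?mulr1// pnatr_eq0 addn2. Qed.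

Lemma binc_ge0 k : 0 <= binc k.
Proof. by apply: prodr_ge0 => j _; rewrite divr_ge0. Qed.

Lemma binc_le1 k : binc k <= 1.
Proof.
apply: prodr_ile1 => j _; rewrite divr_ge0//= ler_pdivrMr ?mul1r ?ler_nat ?ltr0n ?addn2//.
by rewrite addn1.
Qed.

Lemma asin_coef_ge0 k : 0 <= asin_coef k.
Proof. by rewrite divr_ge0// binc_ge0. Qed.

Definition asin_poly N y : R := \sum_(k < N) asin_coef k * y ^+ (2 * k + 1).

(** The derivative of [t - asin_poly N (sin t)]: the [binc k] are the coefficients of (1 -
    y^2)^(-1/2), the derivative of asin. *)
Let slope N t : R := 1 - \sum_(k < N) binc k * (cos t * sin t ^+ (2 * k)).

Let is_derive_asin_rem N t :
  is_derive t 1 (fun t => t - asin_poly N (sin t)) (slope N t).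
Proof.
elim: N => [|N IH].
  rewrite /slope big_ord0 subr0 (_ : (fun t => _) = id); first exact: is_derive_id.
  by apply/funext => x; rewrite /asin_poly big_ord0 subr0.
have -> : (fun t => t - asin_poly N.+1 (sin t)) =
    (fun t => (t - asin_poly N (sin t)) - asin_coef N * sin t ^+ (2 * N).+1).
  by apply/funext => x; rewrite /asin_poly big_ord_recr opprD addrA addn1.
apply: (is_derive_eq (is_deriveB IH (is_deriveM (is_derive_cst (asin_coef N) _ _)
  (is_derive_exprS (2 * N) (is_derive_sin t))))).
rewrite /slope big_ord_recr/= [in RHS]opprD [RHS]addrA; congr (_ - _).
rewrite /GRing.scale /= mulr0 addr0 /asin_coef addn1.
have : (2 * N).+1%:R != 0 :> R by rewrite pnatr_eq0.
by move: ((2 * N).+1%:R : R) => m m0; field.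
Qed.

(** With cos^2 = 1 - sin^2 the differentiated sum telescopes through [bincS] to a single term, which
    has the sign of the sine. *)
Let is_derive_slope N t :
  is_derive t 1 (slope N.+1) (binc N * (2 * N + 1)%:R * sin t ^+ (2 * N).+1).
Proof.
elim: N => [|N IH].
  rewrite (_ : slope 1 = (fun t => 1 - cos t)); last first.
    by apply/funext => x; rewrite /slope big_ord1 /binc big_ord0 muln0 expr0; ring.
  apply: (is_derive_eq (is_deriveB (is_derive_cst (1 : R) _ _) (is_derive_cos t))).
  by rewrite /binc big_ord0 expr1; ring.
have -> : slope N.+2 =
    (fun t => slope N.+1 t - binc N.+1 * (cos t * sin t ^+ (2 * N).+2)).
  by apply/funext => x; rewrite /slope big_ord_recr opprD addrA mulnS.
apply: (is_derive_eq (is_deriveB IH (is_deriveM (is_derive_cst (binc N.+1) _ _)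
  (is_deriveM (is_derive_cos t) (is_derive_exprS (2 * N).+1 (is_derive_sin t)))))).
rewrite /GRing.scale /= -bincS mulr0 addr0 addn2.
have cs : cos t * cos t = 1 - sin t ^+ 2 by rewrite -(cos2Dsin2 t); ring.
have -> : (2 * N.+1 + 1)%:R = (2 * N).+2%:R + 1 :> R by rewrite addn1 mulnS natr1.
rewrite mulnS !exprS.
rewrite [LHS](_ : _ = binc N.+1 * (sin t * sin t ^+ (2 * N)) *
   ((2 * N).+2%:R * (1 - cos t * cos t) + sin t ^+ 2)); last by ring.
by rewrite cs; ring.
Qed.

Let slope0 N : slope N.+1 0 = 0.
Proof.
rewrite /slope big_ord_recl big1 => [|i _]; last by rewrite sin0 expr0n mulr0 mulr0.
by rewrite muln0 expr0 cos0 /binc big_ord0 !mulr1 addr0 subrr.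
Qed.

Let asin_poly0 N : asin_poly N (sin 0) = 0.
Proof. by rewrite /asin_poly big1// => i _; rewrite sin0 expr0n addn1 mulr0. Qed.

Let sin_ge0 x : 0 <= x <= pi / 2 -> 0 <= sin x :> R.
Proof.
move=> /andP[x0 xpi]; apply: sin_ge0_pi; rewrite x0 (le_trans xpi)//.
by rewrite ler_pdivrMr// ler_peMr ?pi_ge0// ler1n.
Qed.

(** The difference has a nonnegative second derivative on [0, pi / 2], and it and its first
    derivative vanish at 0. The latter needs at least one term, hence [N.+1]. *)
Lemma asin_poly_le N t : 0 <= t <= pi / 2 -> asin_poly N.+1 (sin t) <= t.
Proof.
move=> tpi; rewrite -subr_ge0.
apply: (@nneg_of_derive _ (slope N.+1) (pi / 2) (is_derive_asin_rem N.+1)) => //.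
  by rewrite asin_poly0 subr0.
apply: (@nneg_of_derive _ _ (pi / 2) (is_derive_slope N)) => // x xpi.
by rewrite !mulr_ge0 ?binc_ge0// exprn_ge0// sin_ge0.
Qed.

(** The previous bound at t = pi / 2, where the sine is 1. This summability at the end point is what
    dominates the series of translates. *)
Lemma sum_asin_coef_le N : \sum_(k < N) asin_coef k <= pi / 2.
Proof.
apply: (@le_trans _ _ (asin_poly N.+1 (sin (pi / 2)))).
  rewrite /asin_poly big_ord_recr/= sin_pihalf expr1n mulr1 ler_wpDr ?asin_coef_ge0//.
  by apply: ler_sum => k _; rewrite expr1n mulr1.
by apply: asin_poly_le; rewrite lexx divr_ge0// pi_ge0.
Qed.

Lemma asin_polyN N y : asin_poly N (- y) = - asin_poly N y.
Proof.
rewrite /asin_poly -sumrN; apply: eq_bigr => k _.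
by rewrite exprNn addn1 exprS exprM sqrrN expr1n expr1n mulr1 mulN1r mulrN.
Qed.

Lemma asin_poly_approx N t : `|t| <= 2^-1 ->
  `|t - asin_poly N.+1 (sin t)| <= 2 * (3 / 4) ^+ (2 * N).+1.
Proof.
wlog t0 : t / 0 <= t.
  move=> H; have [|t0] := leP 0 t; first exact: H.
  have := H (- t); rewrite oppr_ge0 => /(_ (ltW t0)).
  by rewrite normrN sinN asin_polyN -opprD normrN.
rewrite ger0_norm// => t12.
have h12 : 2^-1 <= pi / 2 :> R by have := @pi_ge2 R; lra.
have tpi : 0 <= t <= pi / 2 by rewrite t0 (le_trans t12).
rewrite ger0_norm ?subr_ge0 ?asin_poly_le//.
(* Bounds the second derivative on [0, 1/2], as [binc N <= 1] and sin y <= y <= 1/2. Two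
   integrations over an interval of length at most 1 preserve the bound. *)
pose c : R := (2 * N).+1%:R * 2^-1 ^+ (2 * N).+1.
have c0 : 0 <= c by rewrite mulr_ge0.
have dslope (x : R) : is_derive x 1 (fun x => c * x - slope N.+1 x)
    (c - binc N * (2 * N + 1)%:R * sin x ^+ (2 * N).+1).
  apply: (is_derive_eq (is_deriveB (is_deriveM (is_derive_cst c _ _) (is_derive_id x 1))
    (is_derive_slope N x))).
  by rewrite /GRing.scale /= mulr0 addr0 mulr1.
have dasin (x : R) : is_derive x 1 (fun x => c * x - (x - asin_poly N.+1 (sin x)))
    (c - slope N.+1 x).
  apply: (is_derive_eq (is_deriveB (is_deriveM (is_derive_cst c _ _) (is_derive_id x 1))
    (is_derive_asin_rem N.+1 x))).
  by rewrite /GRing.scale /= mulr0 addr0 mulr1.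
have ct x : 0 <= x <= 2^-1 -> c * x <= c.
  move=> /andP[x0 x12]; rewrite ler_piMr// (le_trans x12)//.
  by rewrite invf_le1// ler1n.
have sl x : 0 <= x <= 2^-1 -> slope N.+1 x <= c.
  move=> xb; apply: le_trans (ct _ xb); rewrite -subr_ge0.
  apply: (nneg_of_derive dslope _ _ xb); first by rewrite mulr0 slope0 subrr.
  move=> y yb; have /andP[y0 y12] := yb.
  have sy : 0 <= sin y by apply: sin_ge0; rewrite y0 (le_trans y12).
  rewrite subr_ge0 addn1 -mulrA.
  apply: (@le_trans _ _ ((2 * N).+1%:R * sin y ^+ (2 * N).+1)).
    by rewrite ler_piMl ?binc_le1// mulr_ge0// exprn_ge0.
  rewrite ler_wpM2l// lerXn2r ?nnegrE//.
  by rewrite -(ger0_norm sy) (le_trans (normr_sin_le _))// ger0_norm.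
have tb : 0 <= t <= 2^-1 by rewrite t0.
have : t - asin_poly N.+1 (sin t) <= c.
  apply: le_trans (ct _ tb); rewrite -subr_ge0.
  apply: (nneg_of_derive dasin _ _ tb); first by rewrite mulr0 asin_poly0 !subr0.
  by move=> y yb; rewrite subr_ge0 sl.
move=> /le_trans; apply; rewrite /c; set m := (2 * N).+1.
(* A Bernoulli inequality: the linear factor m of [c] is at most 2 (3/2)^m, which leaves the
   geometric rate 3/4. *)
have bern k : 1 + k%:R / 2 <= (3 / 2) ^+ k :> R.
  elim: k => [|k IH]; first by rewrite mul0r addr0 expr0.
  rewrite exprS -natr1.
  have k0 : 0 <= k%:R :> R by [].
  by nra.
have -> : (3 / 4) ^+ m = (3 / 2) ^+ m * 2^-1 ^+ m :> R.
  by rewrite -exprMn; congr (_ ^+ _); field.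
rewrite mulrA ler_wpM2r// ?exprn_ge0//.
by have := bern m; lra.
Qed.

End trigonometric_expansions.

(** * Functions with compactly supported spectrum *)

Section compactly_supported_spectrum.
Context {R : realType} {n : nat}.
Notation leb := (@lebesgue_rV R n).
Implicit Types (a m : 'rV[R]_n -> R) (x v xi : 'rV[R]_n) (th s K : R).

Lemma normr_coord_le x i : `|x 0 i| <= `|x|.
Proof.
rewrite {2}/Num.Def.normr/= mx_normrE.
by rewrite (le_bigmax _ (fun ij : 'I_1 * 'I_n => `|x ij.1 ij.2|) (0, i)).
Qed.

Lemma normr_rV_le x s : 0 <= s -> (forall i, `|x 0 i| <= s) -> `|x| <= s.
Proof.
move=> s0 xs; rewrite {1}/Num.Def.normr/= mx_normrE.
by apply/bigmax_leP; split=> // -[j i] _ /=; rewrite (ord1 j).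
Qed.

Lemma measurable_cube s : 0 <= s -> measurable (@cube R n s) /\ (leb (cube s) < +oo)%E.
Proof.
move=> s0.
have [|mb Eb] := @lebesgue_rV_box R n (const_mx (- s)) (const_mx s).
  by move=> i; rewrite !mxE ge0_cp.
have -> : cube s = [set x : 'rV[R]_n |
    forall i, (const_mx (- s) : 'rV_n) 0 i <= x 0 i <= (const_mx s : 'rV_n) 0 i].
  apply/seteqP; split=> x /= xs.
    by move=> i; rewrite !mxE -ler_norml (le_trans (normr_coord_le _ _)).
  by apply: normr_rV_le => // i; have := xs i; rewrite !mxE -ler_norml.
by split => //; rewrite Eb ltry.
Qed.

Definition spectral_density s a :=
  leb.-integrable setT (EFin \o a) /\ forall xi, ~ cube s xi -> a xi = 0.

Lemma spectral_densityM s a m K : spectral_density s a -> measurable_fun setT m ->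
  (forall xi, cube s xi -> `|m xi| <= K) ->
  spectral_density s (fun xi => m xi * a xi).
Proof.
move=> [ia sa] mm mK; split; last by move=> xi /sa ->; rewrite mulr0.
apply: (@le_integrable_EFin _ _ _ _ _ _ (fun xi => K * `|a xi|)) => //.
- by apply: measurable_funM => //; exact: integrable_EFin_measurable ia.
- by apply: integrable_EFinZ => //; exact: integrable_norm.
- move=> xi _; rewrite normrM; have [cxi|/sa ->] := pselect (cube s xi).
    by rewrite ler_wpM2r// mK.
  by rewrite normr0 !mulr0.
Qed.

Lemma dotr_le v xi s : cube s xi -> `|dotr v xi| <= n%:R * `|v| * s.
Proof.
move=> cxi; rewrite /dotr (le_trans (ler_norm_sum _ _ _))//.
rewrite -mulrA mulr_natl -[X in _ *+ X]card_ord -sumr_const; apply: ler_sum => i _.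
rewrite normrM ler_pM// ?normr_coord_le//.
by rewrite (le_trans (normr_coord_le _ _)).
Qed.

(** The expansion in [v] takes place in the kernel, under the integral sign, so it holds before any
    differentiability of the transform is known. The compact support of [a] makes each term
    integrable. *)
Lemma ctrans_cos_rem s a th x v K N : spectral_density s a ->
  (forall xi, cube s xi -> `|dotr v xi| <= K) ->
  leb.-integrable setT
    (EFin \o (fun xi => cos_rem N (dotr x xi + th) (dotr v xi) * a xi)) /\
  ctrans a th (x + v) -
    \sum_(k < N) ctrans (fun xi => dotr v xi ^+ k * a xi) (th + k%:R * (pi / 2)) x / k`!%:R =
  \int[leb]_xi (cos_rem N (dotr x xi + th) (dotr v xi) * a xi).
Proof.
move=> da vK; elim: N => [|N [IH1 IH2]].
  rewrite big_ord0 subr0 /ctrans.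
  under [X in integrable _ _ (_ \o X)]eq_fun do rewrite cos_rem0 addrAC -dotrDl.
  split; first by apply: integrable_cosM; case: da.
  by apply: eq_Rintegral => xi _; rewrite cos_rem0 addrAC -dotrDl.
have [ib _] : spectral_density s (fun xi => dotr v xi ^+ N * a xi).
  apply: (spectral_densityM (K := K ^+ N) da).
    by apply: measurable_funX; exact: measurable_dotr.
  move=> xi /vK vK'; rewrite normrX lerXn2r// nnegrE//.
  by apply: le_trans vK'.
have ic := integrable_cosM x (th + N%:R * (pi / 2)) ib.
have id := integrable_EFinZ (N`!%:R^-1) measurableT ic.
have E xi : cos_rem N.+1 (dotr x xi + th) (dotr v xi) * a xi =
    cos_rem N (dotr x xi + th) (dotr v xi) * a xi -
    N`!%:R^-1 * (cos (dotr x xi + (th + N%:R * (pi / 2))) * (dotr v xi ^+ N * a xi)).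
  by rewrite cos_remS addrA; ring.
split.
  under [X in integrable _ _ (_ \o X)]eq_fun do rewrite E.
  exact: integrable_EFinB.
rewrite big_ord_recr opprD addrA IH2.
under [in RHS]eq_Rintegral do rewrite E.
by rewrite RintegralB// RintegralZl// [_^-1 * _]mulrC.
Qed.

Lemma ctrans_taylor s a th x v K N : spectral_density s a ->
  (forall xi, cube s xi -> `|dotr v xi| <= K) ->
  `|ctrans a th (x + v) -
    \sum_(k < N) ctrans (fun xi => dotr v xi ^+ k * a xi) (th + k%:R * (pi / 2)) x / k`!%:R| <=
  K ^+ N / N`!%:R * \int[leb]_xi `|a xi|.
Proof.
move=> da vK; have [i1 ->] := ctrans_cos_rem th x N da vK.
have [ia sa] := da; have ina := integrable_norm ia.
rewrite -RintegralZl//; apply: le_normr_RintegralW => //.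
- exact: integrable_EFin_measurable i1.
- exact: integrable_EFinZ.
- move=> xi _; rewrite normrM; have [cxi|/sa ->] := pselect (cube s xi); last first.
    by rewrite normr0 !mulr0.
  rewrite ler_wpM2r// (le_trans (normr_cos_rem_le _ _ _))// ler_wpM2r//.
  rewrite lerXn2r ?nnegrE ?vK//; exact: le_trans (vK _ cxi).
Qed.

(** This turns the Taylor bound with two terms into a directional derivative. *)
Lemma is_derive_quadratic (f : 'rV[R]_n -> R) x v (df C : R) :
  (forall h : R, `|f (x + h *: v) - f x - h * df| <= C * h ^+ 2) ->
  is_derive x v f df.
Proof.
move=> fC.
have cv : h^-1 *: (f (h *: v + x) - f x) @[h --> 0^'] --> df.
  apply/cvgrPdist_le => e e0.
  have C0 : 0 <= C.
    by have := fC 1; rewrite expr1n mulr1; exact: le_trans.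
  have d0 : 0 < e / (C + 1) by rewrite divr_gt0// ltr_wpDl.
  near=> h.
  have h0 : h != 0 by near: h; exact: nbhs_dnbhs_neq.
  have hd : `|h| <= e / (C + 1).
    near: h; apply: dnbhs0_le; exact: d0.
  rewrite /GRing.scale /=.
  have -> : df - h^-1 * (f (h *: v + x) - f x) = - h^-1 * (f (x + h *: v) - f x - h * df).
    by rewrite addrC [h *: v + x]addrC; field.
  rewrite normrM normrN normfV ler_pdivrMl ?normr_gt0//.
  rewrite (le_trans (fC h))// -real_normK ?num_real// mulrA [leRHS]mulrC ler_wpM2r//.
  move: hd; rewrite ler_pdivlMr ?ltr_wpDl// => hd; apply: le_trans hd.
  by rewrite mulrC ler_wpM2l// lerDl.
apply: DeriveDef; first by apply/cvg_ex; exists df.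
exact: cvg_lim cv.
Unshelve. all: by end_near. Qed.

Lemma dotr_delta i xi : dotr (delta_mx 0 i) xi = xi 0 i.
Proof.
rewrite /dotr (bigD1 i)//= big1 ?addr0 => [|j ji].
  by rewrite mxE !eqxx mul1r.
by rewrite mxE (negPf ji) mul0r.
Qed.

Lemma ctrans_expr0 v a th x :
  ctrans (fun xi => dotr v xi ^+ 0 * a xi) (th + 0%:R * (pi / 2)) x = ctrans a th x.
Proof.
rewrite mul0r addr0; apply: eq_Rintegral => xi _.
by rewrite expr0 mul1r.
Qed.

Lemma is_derive_ctrans s a th x i : spectral_density s a ->
  is_derive x (delta_mx 0 i) (ctrans a th) (ctrans (fun xi => xi 0 i * a xi) (th + pi / 2) x).
Proof.
move=> da; apply: (@is_derive_quadratic _ _ _ _ (s ^+ 2 / 2 * \int[leb]_xi `|a xi|)) => h.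
have hK xi : cube s xi -> `|dotr (h *: delta_mx 0 i) xi| <= `|h| * s.
  move=> cxi; rewrite dotrZl dotr_delta normrM ler_wpM2l//.
  by rewrite (le_trans (normr_coord_le _ _)).
have := ctrans_taylor th x 2 da hK.
have [ib _] : spectral_density s (fun xi => xi 0 i * a xi).
  apply: (spectral_densityM (K := s) da); first exact: measurable_coord.
  by move=> xi; apply: le_trans; exact: normr_coord_le.
have E1 : ctrans (fun xi => dotr (h *: delta_mx 0 i) xi ^+ 1 * a xi) (th + 1 * (pi / 2)) x =
    h * ctrans (fun xi => xi 0 i * a xi) (th + pi / 2) x.
  rewrite -ctransZ// mul1r; apply: eq_Rintegral => xi _.
  by rewrite expr1 dotrZl dotr_delta !mulrA.
rewrite big_ord_recr big_ord1 /= ctrans_expr0 E1 fact0 !divr1 opprD addrA.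
move=> /le_trans; apply; rewrite exprMn real_normK ?num_real//.
by rewrite [leRHS](_ : _ = h ^+ 2 * s ^+ 2 / 2 * \int[leb]_xi `|a xi|) //; ring.
Qed.

Lemma continuous_ctrans s a th : spectral_density s a -> continuous (ctrans a th).
Proof.
move=> da x; apply: (iffRL (@cvgrPdist_le _ _ _ (nbhs x) _ _ _)) => e e0.
pose C := n%:R * `|s| * \int[leb]_xi `|a xi|.
have C0 : 0 <= C by rewrite !mulr_ge0// Rintegral_ge0.
have d0 : 0 < e / (C + 1) by rewrite divr_gt0// ltr_wpDl.
apply/nbhs_ballP; exists (e / (C + 1)) => // y; rewrite mx_norm_ball /ball_/= => xy.
have yd : `|y - x| <= e / (C + 1) by rewrite distrC ltW.
have hK xi : cube s xi -> `|dotr (y - x) xi| <= n%:R * `|y - x| * `|s|.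
  move=> /dotr_le/le_trans; apply; rewrite ler_wpM2l ?mulr_ge0//.
  exact: ler_norm.
have := ctrans_taylor th x 1 da hK.
rewrite big_ord1 ctrans_expr0 fact0 divr1 expr1 divr1 subrKC distrC => /le_trans; apply.
move: yd; rewrite ler_pdivlMr ?ltr_wpDl// => yd; apply: le_trans yd.
rewrite [leLHS](_ : _ = `|y - x| * C); last by rewrite /C; ring.
by rewrite ler_wpM2l// lerDl.
Qed.

Lemma ctrans_shiftB s a th x v : spectral_density s a ->
  ctrans a th (x + v) - ctrans a th (x - v) =
  2 * ctrans (fun xi => sin (dotr v xi) * a xi) (th + pi / 2) x.
Proof.
move=> da; have [ia _] := da.
have [ib _] : spectral_density s (fun xi => sin (dotr v xi) * a xi).
  apply: (spectral_densityM (K := 1) da).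
    apply: measurableT_comp (measurable_dotr v).
    by apply: continuous_measurable_fun; exact: continuous_sin.
  by move=> xi _; rewrite ler_norml sin_geN1 sin_le1.
rewrite /ctrans -RintegralB//; try exact: integrable_cosM.
rewrite -RintegralZl//; last exact: integrable_cosM.
apply: eq_Rintegral => xi _.
rewrite dotrDl dotrBl addrA cosD_pihalf.
rewrite [_ + dotr v xi + th]addrAC [_ - dotr v xi + th]addrAC cosD cosB.
by ring.
Qed.

End compactly_supported_spectrum.

(** * Real band-limited functions *)

Section real_band_limited.
Context {R : realType} {n : nat}.
Notation leb := (@lebesgue_rV R n).
Implicit Types (u w a b : 'rV[R]_n -> R) (x v xi : 'rV[R]_n) (th s h : R).

Definition band_real s u :=
  [/\ leb.-integrable setT (EFin \o u), continuous u &
   forall xi, ~ cube s xi -> ctrans u 0 xi = 0 /\ ctrans u (pi / 2) xi = 0].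

Lemma band_real_ctrans0 s u th xi : band_real s u -> ~ cube s xi -> ctrans u th xi = 0.
Proof.
move=> [iu _ u0] /u0[e1 e2].
by rewrite ctrans_phase// e1 e2 !mulr0 addr0.
Qed.

Lemma spectral_density_ctrans s u th : 0 <= s -> band_real s u ->
  spectral_density s (ctrans u th).
Proof.
move=> s0 bu; split; last by move=> xi; exact: band_real_ctrans0 bu.
have [iu _ _] := bu; have [mc fc] := measurable_cube (n := n) s0.
apply: (@le_integrable_EFin _ _ _ _ _ _ (fun xi => (\int[leb]_y `|u y|) * \1_(cube s) xi)) => //.
- by apply: (measurable_ctrans (phi := fun=> th)) => //.
- apply: integrable_EFinZ => //; apply/integrableP; split.
    exact/measurable_EFinP/measurable_indic.
  under eq_integral do rewrite /= ger0_norm//.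
  by rewrite integral_indic// setIT.
- move=> xi _; rewrite indicE; have [cxi|cxi] := pselect (cube s xi).
    by rewrite mem_set// mulr1 normr_ctrans_le.
  by rewrite memNset// mulr0 (band_real_ctrans0 _ bu)// normr0.
Qed.

(** The transform is bounded and vanishes off the cube, hence is integrable, and inversion applies.
    Splitting the phase [- dotr x xi] by the addition formula yields the two densities. *)
Lemma band_real_repr s u : 0 <= s -> band_real s u ->
  exists a b, [/\ spectral_density s a, spectral_density s b &
    u = (fun x => ctrans a 0 x + ctrans b (pi / 2) x)].
Proof.
move=> s0 bu; have [iu cu _] := bu.
pose k : R := ((2 * pi) ^+ n)^-1.
have k0 : (2 * pi) ^+ n != 0 :> R by rewrite expf_neq0// mulf_neq0// gt_eqF// pi_gt0.
have [i1 z1] := spectral_density_ctrans 0 s0 bu.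
have [i2 z2] := spectral_density_ctrans (pi / 2) s0 bu.
exists (fun xi => k * ctrans u 0 xi), (fun xi => k * ctrans u (pi / 2) xi); split.
- split; first exact: integrable_EFinZ.
  by move=> xi /z1 ->; rewrite mulr0.
- split; first exact: integrable_EFinZ.
  by move=> xi /z2 ->; rewrite mulr0.
apply/funext => x; rewrite !ctransZ// -mulrDr.
apply: (mulfI k0); rewrite mulrA mulfV// mul1r.
have V xi : ctrans u (- dotr x xi) xi =
    cos (dotr x xi + 0) * ctrans u 0 xi + cos (dotr x xi + pi / 2) * ctrans u (pi / 2) xi.
  by rewrite ctrans_phase// cosN sinN addr0 cosD_pihalf.
have j1 := integrable_cosM x 0 i1.
have j2 := integrable_cosM x (pi / 2) i2.
rewrite fourier_inversion//; [|exact: cu|].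
  by under eq_Rintegral do rewrite V; rewrite RintegralD.
by under [X in integrable _ _ (_ \o X)]eq_fun do rewrite V; exact: integrable_EFinD.
Qed.

Lemma band_realD s u w : band_real s u -> band_real s w ->
  band_real s (fun x => u x + w x).
Proof.
move=> bu bw; have [iu cu _] := bu; have [iw cw _] := bw; split.
- exact: integrable_EFinD.
- by move=> x; exact: (cvgD (cu x) (cw x)).
- move=> xi cxi; rewrite !ctransD//.
  by rewrite !(band_real_ctrans0 _ bu)// !(band_real_ctrans0 _ bw)// addr0.
Qed.

Lemma band_realZ s k u : band_real s u -> band_real s (fun x => k * u x).
Proof.
move=> bu; have [iu cu _] := bu; split.
- exact: integrable_EFinZ.
- by move=> x; exact: (cvgM (cvg_cst _) (cu x)).
- by move=> xi cxi; rewrite !ctransZ// !(band_real_ctrans0 _ bu)// mulr0.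
Qed.

Lemma band_real0 s : band_real s (fun=> 0).
Proof.
split.
- apply/integrableP; split; first exact/measurable_EFinP/measurable_cst.
  by under eq_integral do rewrite /= normr0; rewrite integral0 ltry.
- exact: cst_continuous.
- move=> xi _; rewrite /ctrans; under eq_Rintegral do rewrite mulr0.
  by under [in X in _ /\ X]eq_Rintegral do rewrite mulr0; rewrite Rintegral_cst// mul0r.
Qed.

(** A translation changes only the phase of the transform, and the transform vanishes off the cube
    for every phase. *)
Lemma band_real_addr s v u : band_real s u -> band_real s (fun x => u (x + v)).
Proof.
move=> bu; have [iu cu _] := bu; split.
- exact: (integrable_lebesgue_rV_addr v iu).
- move=> x; have cx : (fun y => y + v) @ nbhs x --> x + v.
    exact: (@cvgD _ _ _ (nbhs x) _ _ _ _ _ cvg_id (cvg_cst v)).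
  exact: (cvg_comp (fun y => y + v) u cx (cu _)).
- have E th xi : ctrans (fun x => u (x + v)) th xi = ctrans u (th - dotr xi v) xi.
    rewrite /ctrans /Rintegral; congr fine.
    rewrite -(integral_lebesgue_rV_addr v
      (f := fun x => (cos (dotr xi x + (th - dotr xi v)) * u x)%:E)).
      apply: eq_integral => x _; congr ((cos _ * _)%:E).
      by rewrite (dotrC xi (x + v)) dotrDl (dotrC x) (dotrC v); ring.
    apply/measurable_EFinP; apply: measurable_funM; first exact: measurable_cos_dotr.
    exact: integrable_EFin_measurable iu.
  by move=> xi cxi; rewrite !E !(band_real_ctrans0 _ bu).
Qed.

Definition half_difference v u x := 2^-1 * (u (x + v) - u (x - v)).

Lemma band_real_half_difference s v u : band_real s u ->
  band_real s (half_difference v u).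
Proof.
move=> bu; apply: band_realZ.
have := band_realD (band_real_addr v bu) (band_realZ (-1) (band_real_addr (- v) bu)).
by congr band_real; apply/funext => x; rewrite mulN1r.
Qed.

(** The factor 1/2 makes the difference of two translates an L1 contraction, so all its iterates
    keep the L1 bound of u. *)
Lemma Rintegral_half_difference s v u : band_real s u ->
  \int[leb]_x `|half_difference v u x| <= \int[leb]_x `|u x|.
Proof.
move=> bu; have [iu cu _] := bu.
have E t : \int[leb]_x `|u (x + t)| = \int[leb]_x `|u x|.
  rewrite /Rintegral; congr fine.
  apply: (integral_lebesgue_rV_addr t (f := fun x => `|u x|%:E)).
  apply/measurable_EFinP; apply: measurableT_comp => //.
  exact: integrable_EFin_measurable iu.
have I t : leb.-integrable setT (EFin \o (fun x => `|u (x + t)|)).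
  by have [i1 _ _] := band_real_addr t bu; exact: integrable_norm i1.
have [i0 _ _] := band_real_half_difference v bu.
apply: (@le_trans _ _ (\int[leb]_x (2^-1 * (`|u (x + v)| + `|u (x - v)|)))).
  apply: le_Rintegral => //.
  - exact: integrable_norm i0.
  - by apply: integrable_EFinZ => //; exact: integrable_EFinD.
  - move=> x _; rewrite /half_difference normrM gtr0_norm ?invr_gt0//.
    by rewrite ler_wpM2l// ler_normB.
rewrite RintegralZl//; last exact: integrable_EFinD.
by rewrite RintegralD// !E; lra.
Qed.

Lemma band_real_iter s v u k : band_real s u ->
  band_real s (iter k (half_difference v) u) /\
  \int[leb]_x `|iter k (half_difference v) u x| <= \int[leb]_x `|u x|.
Proof.
move=> bu; elim: k => [//|k [IH1 IH2]] /=; split.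
  exact: band_real_half_difference.
exact: le_trans (Rintegral_half_difference v IH1) IH2.
Qed.

End real_band_limited.

(** * Derivatives as series of translates *)

Section bernstein_space.
Context {R : realType} {n : nat}.
Notation leb := (@lebesgue_rV R n).
Implicit Types (u w a b : 'rV[R]_n -> R) (x v xi : 'rV[R]_n) (th s h : R).

Lemma spectral_density_sin s v a : spectral_density s a ->
  spectral_density s (fun xi => sin (dotr v xi) * a xi).
Proof.
move=> da; apply: (spectral_densityM (K := 1) da).
  apply: measurableT_comp (measurable_dotr v).
  by apply: continuous_measurable_fun; exact: continuous_sin.
by move=> xi _; rewrite ler_norml sin_geN1 sin_le1.
Qed.

Lemma spectral_density_sinX s v a k : spectral_density s a ->
  spectral_density s (fun xi => sin (dotr v xi) ^+ k * a xi).
Proof.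
move=> da; elim: k => [|k /(spectral_density_sin v)].
  by under eq_fun do rewrite expr0 mul1r.
by under eq_fun do rewrite mulrA -exprS.
Qed.

Lemma ctrans_pi a th x : leb.-integrable setT (EFin \o a) ->
  ctrans a (th + pi) x = - ctrans a th x.
Proof.
move=> ia; rewrite -mulN1r -ctransZ//; apply: eq_Rintegral => xi _.
by rewrite addrA cosDpi mulN1r mulrN mulNr.
Qed.

Lemma iter_half_difference_ctrans s v a b k :
  spectral_density s a -> spectral_density s b ->
  iter k (half_difference v) (fun x => ctrans a 0 x + ctrans b (pi / 2) x) =
  (fun x => ctrans (fun xi => sin (dotr v xi) ^+ k * a xi) (k%:R * (pi / 2)) x +
     ctrans (fun xi => sin (dotr v xi) ^+ k * b xi) (k.+1%:R * (pi / 2)) x).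
Proof.
move=> da db; elim: k => [|k /= ->].
  apply/funext => x /=; rewrite mul0r mul1r.
  by congr (_ + _); apply: eq_Rintegral => xi _; rewrite expr0 mul1r.
apply/funext => x; rewrite /half_difference opprD addrACA.
rewrite (ctrans_shiftB _ _ _ (spectral_density_sinX v k da)).
rewrite (ctrans_shiftB _ _ _ (spectral_density_sinX v k db)).
rewrite -mulrDr mulKf//.
have E (t : R) : t * (pi / 2) + pi / 2 = (t + 1) * (pi / 2) by ring.
by rewrite !E !natr1; congr (_ + _); apply: eq_Rintegral => xi _; rewrite exprS !mulrA.
Qed.

(* [D], the half difference, has symbol [i sin (v.xi)], so that
   [\sum_k asin_coef k (-1)^k D^(2k+1)] has symbol [i asin (sin (v.xi)) = i v.xi]
   when [|v.xi| <= pi / 2]: a directional derivative is an absolutely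
   convergent series of translations. *)
Definition asin_difference v N u x : R :=
  \sum_(k < N) asin_coef k * ((-1) ^+ k * iter (2 * k + 1) (half_difference v) u x).

Lemma ctrans_odd a k x : leb.-integrable setT (EFin \o a) ->
  (-1) ^+ k * ctrans a ((2 * k + 1)%:R * (pi / 2)) x = ctrans a (pi / 2) x /\
  (-1) ^+ k * ctrans a ((2 * k + 1).+1%:R * (pi / 2)) x = ctrans a pi x.
Proof.
move=> ia; have key th : (-1) ^+ k * ctrans a (th + k%:R * pi) x = ctrans a th x.
  elim: k => [|k IH]; first by rewrite mul1r mul0r addr0.
  by rewrite -natr1 mulrDl mul1r addrA ctrans_pi// exprS mulN1r mulrNN.
split; rewrite -[RHS]key; congr (_ * ctrans _ _ _).
  by rewrite natrD natrM; field.
by rewrite -natr1 natrD natrM; field.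
Qed.

(** The densities are part of the conclusion because the additivity of [ctrans] needs their
    integrability at each step of the induction. *)
Lemma asin_difference_ctrans s v a b N x :
  spectral_density s a -> spectral_density s b ->
  asin_difference v N (fun x => ctrans a 0 x + ctrans b (pi / 2) x) x =
  ctrans (fun xi => asin_poly N (sin (dotr v xi)) * a xi) (pi / 2) x +
  ctrans (fun xi => asin_poly N (sin (dotr v xi)) * b xi) pi x /\
  (spectral_density s (fun xi => asin_poly N (sin (dotr v xi)) * a xi) /\
   spectral_density s (fun xi => asin_poly N (sin (dotr v xi)) * b xi)).
Proof.
move=> da db; have [ia _] := da; have [ib _] := db.
have asinS N' y : asin_poly N'.+1 y = asin_poly N' y + asin_coef N' * y ^+ (2 * N' + 1).
  by rewrite /asin_poly big_ord_recr.
elim: N => [|N [IH [IHa IHb]]].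
  have E c : (fun xi => asin_poly 0 (sin (dotr v xi)) * c xi) = (fun xi => 0 * c xi).
    by apply/funext => xi; rewrite /asin_poly big_ord0.
  rewrite !E /asin_difference big_ord0 !ctransZ// !mul0r addr0; split => //.
  have zero c : spectral_density s c -> spectral_density s (fun xi => 0 * c xi).
    by move=> dc; apply: (spectral_densityM (K := 0) dc) => // xi _; rewrite normr0.
  by split; exact: zero.
have E c : (fun xi => asin_poly N.+1 (sin (dotr v xi)) * c xi) =
    (fun xi => asin_poly N (sin (dotr v xi)) * c xi +
       asin_coef N * (sin (dotr v xi) ^+ (2 * N + 1) * c xi)).
  by apply/funext => xi; rewrite asinS mulrDl mulrA.
have dX c : spectral_density s c ->
    spectral_density s (fun xi => asin_coef N * (sin (dotr v xi) ^+ (2 * N + 1) * c xi)).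
  move=> /(spectral_density_sinX v (2 * N + 1))[i1 z1]; split.
    exact: integrable_EFinZ.
  by move=> xi /z1 ->; rewrite mulr0.
have [i1 _] := dX _ da; have [i2 _] := dX _ db.
have [j1 _] := spectral_density_sinX v (2 * N + 1) da.
have [j2 _] := spectral_density_sinX v (2 * N + 1) db.
have [k1 z1] := IHa; have [k2 z2] := IHb.
rewrite !E; split; last first.
  split; (split; first exact: integrable_EFinD).
    by move=> xi cxi; have [_ /(_ _ cxi) ->] := dX _ da; rewrite z1// addr0.
  by move=> xi cxi; have [_ /(_ _ cxi) ->] := dX _ db; rewrite z2// addr0.
rewrite !ctransD// !ctransZ//.
rewrite /asin_difference big_ord_recr/= -/(asin_difference v N _ x) IH.
rewrite (iter_half_difference_ctrans _ _ da db) mulrDr.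
have [-> _] := ctrans_odd N x j1; have [_ ->] := ctrans_odd N x j2.
by rewrite mulrDr addrACA.
Qed.

Lemma ctrans_dist_le s a (m m' : 'rV[R]_n -> R) e th x : 
  spectral_density s a ->
  spectral_density s (fun xi => m xi * a xi) ->
  spectral_density s (fun xi => m' xi * a xi) ->
  (forall xi, cube s xi -> `|m xi - m' xi| <= e) ->
  `|ctrans (fun xi => m xi * a xi) th x - ctrans (fun xi => m' xi * a xi) th x| <=
  e * \int[leb]_xi `|a xi|.
Proof.
move=> [ia za] [i1 _] [i2 _] mm'.
rewrite -[X in _ - X]mul1r -mulNr -ctransZ// -ctransD//; last exact: integrable_EFinZ.
have i3 := integrable_EFinD measurableT i1 (integrable_EFinZ (-1) measurableT i2).
apply: (le_trans (normr_ctrans_le _ _ i3)).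
rewrite -RintegralZl//; last exact: integrable_norm.
apply: le_Rintegral => //.
- exact: integrable_norm i3.
- by apply: integrable_EFinZ => //; exact: integrable_norm.
- move=> xi _; rewrite mulN1r -mulrBl normrM.
  have [cxi|/za ->] := pselect (cube s xi); last by rewrite normr0 !mulr0.
  by rewrite ler_wpM2r// mm'.
Qed.

Lemma spectral_density_coord s a i : spectral_density s a ->
  spectral_density s (fun xi => xi 0 i * a xi).
Proof.
move=> da; apply: (spectral_densityM (K := s) da); first exact: measurable_coord.
by move=> xi; apply: le_trans; exact: normr_coord_le.
Qed.

Lemma is_derive_ctrans2 s a b x i : spectral_density s a -> spectral_density s b ->
  is_derive x (delta_mx 0 i) (fun x => ctrans a 0 x + ctrans b (pi / 2) x)
    (ctrans (fun xi => xi 0 i * a xi) (pi / 2) x + ctrans (fun xi => xi 0 i * b xi) pi x).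
Proof.
move=> da db.
apply: (is_derive_eq (is_deriveD (is_derive_ctrans 0 x i da)
  (is_derive_ctrans (pi / 2) x i db))).
by rewrite add0r; congr (_ + ctrans _ _ _); field.
Qed.

Lemma derive_ctrans2 s a b x i : spectral_density s a -> spectral_density s b ->
  'D_(delta_mx 0 i) (fun x => ctrans a 0 x + ctrans b (pi / 2) x) x =
  ctrans (fun xi => xi 0 i * a xi) (pi / 2) x + ctrans (fun xi => xi 0 i * b xi) pi x.
Proof. by move=> da db; exact: (@derive_val _ _ _ _ _ _ _ (is_derive_ctrans2 x i da db)). Qed.

(** On the cube |v.xi| = |h xi_i| <= 1/2, so the symbols converge uniformly at a geometric rate;
    integration against the densities gives convergence at each x. *)
Lemma asin_difference_cvg s u v i h : 0 <= s -> band_real s u ->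
  v = h *: delta_mx 0 i -> `|h| * s <= 2^-1 ->
  forall x, asin_difference v N.+1 u x @[N --> \oo] --> h * 'D_(delta_mx 0 i) u x.
Proof.
move=> s0 bu vE hs x; have [a [b [da db ->]]] := band_real_repr s0 bu.
have [ia za] := da; have [ib zb] := db.
rewrite (derive_ctrans2 x i da db).
have dotD c : spectral_density s c -> spectral_density s (fun xi => dotr v xi * c xi).
  move=> dc; apply: (spectral_densityM (K := n%:R * `|v| * s) dc).
    exact: measurable_dotr.
  by move=> xi; exact: dotr_le.
have hZ c th : spectral_density s c -> h * ctrans (fun xi => xi 0 i * c xi) th x =
    ctrans (fun xi => dotr v xi * c xi) th x.
  move=> /(spectral_density_coord i)[ic _]; rewrite -ctransZ//; apply: eq_Rintegral => xi _.
  by rewrite vE dotrZl dotr_delta !mulrA.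
rewrite mulrDr !hZ//.
pose M := \int[leb]_xi `|a xi| + \int[leb]_xi `|b xi|.
have bound N : `|ctrans (fun xi => dotr v xi * a xi) (pi / 2) x +
    ctrans (fun xi => dotr v xi * b xi) pi x -
    asin_difference v N.+1 (fun x => ctrans a 0 x + ctrans b (pi / 2) x) x| <=
    2 * M * (3 / 4) ^+ N.
  have [-> [ea eb]] := asin_difference_ctrans v N.+1 x da db.
  have app xi : cube s xi -> `|dotr v xi - asin_poly N.+1 (sin (dotr v xi))| <= 2 * (3 / 4) ^+ N.
    move=> cxi; apply: (le_trans (asin_poly_approx N _)).
      rewrite vE dotrZl dotr_delta normrM (le_trans _ hs)// ler_wpM2l//.
      by rewrite (le_trans (normr_coord_le _ _)).
    rewrite ler_wpM2l// ler_wiXn2l//; first by lra.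
    by rewrite mul2n -addnn -addSn leq_addl.
  rewrite opprD addrACA (le_trans (ler_normD _ _))//.
  rewrite [leRHS](_ : _ = 2 * (3 / 4) ^+ N * \int[leb]_xi `|a xi| +
     2 * (3 / 4) ^+ N * \int[leb]_xi `|b xi|); last by rewrite /M; ring.
  by apply: lerD; apply: ctrans_dist_le app => //; exact: dotD.
apply/cvgrPdist_le => e e0.
have cv : 2 * M * (3 / 4) ^+ N @[N --> \oo] --> (0 : R).
  rewrite -[X in _ --> X](mulr0 (2 * M)); apply: cvgM; first exact: cvg_cst.
  by apply: cvg_expr; rewrite ger0_norm//; lra.
move/cvgrPdist_le : cv => /(_ _ e0) cv.
near=> N; apply: (le_trans (bound N)).
have : `|0 - 2 * M * (3 / 4) ^+ N| <= e by near: N; exact: cv.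
by rewrite sub0r normrN; apply: le_trans; exact: ler_norm.
Unshelve. all: by end_near. Qed.

Lemma band_real_asin_difference s v N u : band_real s u ->
  band_real s (asin_difference v N u).
Proof.
move=> bu; elim: N => [|N IH].
  have -> : asin_difference v 0 u = (fun=> 0).
    by apply/funext => x; rewrite /asin_difference big_ord0.
  exact: band_real0.
have -> : asin_difference v N.+1 u = (fun x => asin_difference v N u x +
    asin_coef N * ((-1) ^+ N * iter (2 * N + 1) (half_difference v) u x)).
  by apply/funext => x; rewrite /asin_difference big_ord_recr.
apply: band_realD => //; apply: band_realZ; apply: band_realZ.
by have [] := band_real_iter v (2 * N + 1) bu.
Qed.

(** The majorant is the sum of the absolute values of all terms. Its integral is at most pi / 2
    times the L1 norm of u, by contraction and [sum_asin_coef_le]; one majorant serves all partial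
    sums. *)
Lemma asin_difference_dominated s v u : band_real s u ->
  exists2 g, leb.-integrable setT g &
    forall N x, (`|asin_difference v N u x|%:E <= g x)%E.
Proof.
move=> bu; have [iu _ _] := bu.
pose w k x := asin_coef k * `|iter (2 * k + 1) (half_difference v) u x|.
have w0 k x : (0 <= (w k x)%:E)%E by rewrite lee_fin mulr_ge0// asin_coef_ge0.
have iw k : leb.-integrable setT (EFin \o w k).
  have [[i1 _ _] _] := band_real_iter v (2 * k + 1) bu.
  by apply: integrable_EFinZ => //; exact: integrable_norm i1.
have mw k : measurable_fun setT (EFin \o w k) by exact: measurable_int (iw k).
exists (fun x => \sum_(k <oo) (w k x)%:E)%E.
  apply/integrableP; split.
    apply: (@ge0_emeasurable_sum _ _ _ setT (fun k x => (w k x)%:E) xpredT) => //.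
    by move=> k _; exact: mw.
  under eq_integral do rewrite gee0_abs ?nneseries_ge0//.
  rewrite integral_nneseries//.
  apply: (@le_lt_trans _ _ (pi / 2 * \int[leb]_x `|u x|)%:E); last exact: ltry.
  apply: lime_le; first by apply: is_cvg_nneseries => k _ _; exact: integral_ge0.
  apply: nearW => N; rewrite big_mkord.
  under eq_bigr do rewrite -(EFin_Rintegral measurableT (iw _)).
  rewrite sumEFin lee_fin.
  apply: (@le_trans _ _ ((\sum_(k < N) asin_coef k) * \int[leb]_x `|u x|)).
    rewrite mulr_suml; apply: ler_sum => k _.
    have [[i1 _ _] le1] := band_real_iter v (2 * k + 1) bu.
    rewrite RintegralZl//; last exact: integrable_norm i1.
    by rewrite ler_wpM2l// asin_coef_ge0.
  by rewrite ler_wpM2r ?Rintegral_ge0// sum_asin_coef_le.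
move=> N x; apply: (@le_trans _ _ (\sum_(0 <= k < N) (w k x)%:E)%E).
  rewrite big_mkord sumEFin lee_fin (le_trans (ler_norm_sum _ _ _))//.
  apply: ler_sum => k _; rewrite normrM [X in _ * X]normrM normrX normrN1 expr1n mul1r.
  by rewrite (ger0_norm (asin_coef_ge0 k)).
by apply: nneseries_lim_ge => k _ _; exact: w0.
Qed.

Lemma band_real_derive s u i : 0 < s -> band_real s u ->
  band_real s ('D_(delta_mx 0 i) u).
Proof.
(* The largest step for which |h xi_i| <= 1/2 on the whole cube. *)
move=> s0 bu; pose h : R := (2 * s)^-1; pose v : 'rV[R]_n := h *: delta_mx 0 i.
have h0 : h != 0 by rewrite invr_neq0// mulf_neq0// gt_eqF.
have hs : `|h| * s <= 2^-1.
  by rewrite gtr0_norm ?invr_gt0 ?mulr_gt0// /h invfM mulfVK ?gt_eqF.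
have cv := asin_difference_cvg (i := i) (ltW s0) bu erefl hs.
have [g ig dom] := asin_difference_dominated v bu.
have bP N := band_real_asin_difference v N bu.
have mP N : measurable_fun setT (asin_difference v N u).
  by have [iP _ _] := bP N; exact: integrable_EFin_measurable iP.
have -> : 'D_(delta_mx 0 i) u = (fun x => h^-1 * (h * 'D_(delta_mx 0 i) u x)).
  by apply/funext => x; rewrite mulKf.
apply: band_realZ; split.
- have [] := @dominated_cvg_Rintegral_ereal _ _ _ leb setT
    (fun N => asin_difference v N.+1 u) (fun x => h * 'D_(delta_mx 0 i) u x) g measurableT.
  + by move=> N; exact: mP.
  + exact: ig.
  + by move=> N x _; exact: dom.
  + by move=> x _; exact: cv.
  + by [].
(* Continuity does not pass to the pointwise limit; it is read off the inverse transform. *)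
- have [a [b [da db uE]]] := band_real_repr (ltW s0) bu.
  have c1 := continuous_ctrans (th := pi / 2) (spectral_density_coord i da).
  have c2 := continuous_ctrans (th := pi) (spectral_density_coord i db).
  have -> : (fun x => h * 'D_(delta_mx 0 i) u x) =
      (fun x => h * (ctrans (fun xi => xi 0 i * a xi) (pi / 2) x +
        ctrans (fun xi => xi 0 i * b xi) pi x)).
    by apply/funext => x; rewrite uE (derive_ctrans2 x i da db).
  by move=> x; exact: (cvgM (cvg_cst _) (cvgD (c1 x) (c2 x))).
- have key th xi : ~ cube s xi -> ctrans (fun x => h * 'D_(delta_mx 0 i) u x) th xi = 0.
    move=> cxi.
    have [||||_] := @dominated_cvg_Rintegral_ereal _ _ _ leb setT
      (fun N x => cos (dotr xi x + th) * asin_difference v N.+1 u x)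
      (fun x => cos (dotr xi x + th) * (h * 'D_(delta_mx 0 i) u x)) g measurableT.
    + by move=> N; apply: measurable_funM => //; exact: measurable_cos_dotr.
    + exact: ig.
    + move=> N x _; apply: le_trans (dom N.+1 x); rewrite lee_fin normrM.
      by rewrite ler_piMl// normr_cos_le1.
    + by move=> x _; apply: cvgM; [exact: cvg_cst|exact: cv].
    move=> cvI; apply: (cvg_unique (@norm_hausdorff _ R) cvI).
    (* Every partial sum is band-limited, so the transforms converging to this one are all zero at
       xi. *)
    apply: cvg_near_cst; apply: nearW => N.
    exact: (band_real_ctrans0 _ (bP N.+1)).
  by move=> xi cxi; rewrite !key.
Qed.

End bernstein_space.

(** * Taylor expansion of band-limited functions *)

Section complex_modulus.
Context {R : realType}.
Local Open Scope complex_scope.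
Implicit Types z : R[i].

Lemma ReD z1 z2 : complex.Re (z1 + z2) = complex.Re z1 + complex.Re z2.
Proof. by case: z1; case: z2. Qed.

Lemma ImD z1 z2 : complex.Im (z1 + z2) = complex.Im z1 + complex.Im z2.
Proof. by case: z1; case: z2. Qed.

Lemma Re_sum I (r : seq I) (F : I -> R[i]) :
  complex.Re (\sum_(i <- r) F i) = \sum_(i <- r) complex.Re (F i).
Proof. by rewrite (big_morph _ ReD (erefl : complex.Re (0 : R[i]) = 0)). Qed.

Lemma Im_sum I (r : seq I) (F : I -> R[i]) :
  complex.Im (\sum_(i <- r) F i) = \sum_(i <- r) complex.Im (F i).
Proof. by rewrite (big_morph _ ImD (erefl : complex.Im (0 : R[i]) = 0)). Qed.

Lemma Re_rM (r : R) z : complex.Re (r%:C * z) = r * complex.Re z.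
Proof. by case: z => a b /=; rewrite mul0r subr0. Qed.

Lemma Im_rM (r : R) z : complex.Im (r%:C * z) = r * complex.Im z.
Proof. by case: z => a b /=; rewrite mul0r addr0. Qed.

Lemma ReB z1 z2 : complex.Re (z1 - z2) = complex.Re z1 - complex.Re z2.
Proof. by case: z1; case: z2. Qed.

Lemma ImB z1 z2 : complex.Im (z1 - z2) = complex.Im z1 - complex.Im z2.
Proof. by case: z1; case: z2. Qed.

Notation normc := ComplexField.Normc.normc.

Lemma normc_ge0 z : 0 <= normc z.
Proof. by case: z => a b; rewrite /normc sqrtr_ge0. Qed.

Lemma normr_normc z : `|z| = (normc z)%:C.
Proof. by rewrite normc_def; case: z. Qed.

Lemma normc_leD z1 z2 : normc (z1 + z2) <= normc z1 + normc z2.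
Proof. by rewrite -lecR rmorphD/= -!normr_normc ler_normD. Qed.

Lemma normc_sum I (r : seq I) (F : I -> R[i]) :
  normc (\sum_(i <- r) F i) <= \sum_(i <- r) normc (F i).
Proof.
elim: r => [|i r IH]; first by rewrite !big_nil ComplexField.Normc.normc0.
by rewrite !big_cons (le_trans (normc_leD _ _))// lerD2l.
Qed.

Lemma normc_real (r : R) : normc r%:C = `|r|.
Proof. by rewrite /normc /= expr0n addr0 sqrtr_sqr. Qed.

Lemma normc_rM (r : R) z : normc (r%:C * z) = `|r| * normc z.
Proof. by rewrite ComplexField.Normc.normcM normc_real. Qed.

Lemma normc_le_ReIm z : normc z <= `|complex.Re z| + `|complex.Im z|.
Proof.
case: z => a b /=; rewrite -[leRHS]ger0_norm ?addr_ge0// -sqrtr_sqr ler_sqrt ?sqr_ge0//.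
by rewrite sqrrD !real_normK ?num_real// lerD2r lerDl mulrn_wge0// mulr_ge0.
Qed.

End complex_modulus.

Section taylor_words.
Context {R : realType} {n : nat}.
Notation leb := (@lebesgue_rV R n).
Implicit Types (u a b : 'rV[R]_n -> R) (x v xi : 'rV[R]_n) (w : seq 'I_n).

(** Words in place of multi-indices absorb the multinomial coefficients, and their number n^k yields
    the factor d^k of the estimate. *)
Fixpoint words k : seq (seq 'I_n) :=
  if k is k'.+1 then [seq i :: w | i <- enum 'I_n, w <- words k'] else [:: [::]].

Lemma size_words k : size (words k) = (n ^ k)%N.
Proof. by elim: k => //= k IH; rewrite size_allpairs IH size_enum_ord expnS. Qed.

Lemma mem_words k w : w \in words k -> size w = k.
Proof.
elim: k w => [w|k IH w]; first by rewrite inE => /eqP ->.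
by move=> /allpairsP[[i w'] /= [_ /IH <- ->]].
Qed.

Lemma sum_expr_words (F : 'I_n -> R) k :
  (\sum_i F i) ^+ k = \sum_(w <- words k) \prod_(i <- w) F i.
Proof.
elim: k => [|k IH] /=; first by rewrite big_seq1 big_nil.
rewrite big_allpairs_dep big_enum/= exprS IH mulr_suml; apply: eq_bigr => i _.
by rewrite mulr_sumr; apply: eq_bigr => w _; rewrite big_cons.
Qed.

Definition iter_derive w u := foldr (fun i u' => 'D_(delta_mx 0 i) u') u w.

Definition monomial w xi : R := \prod_(i <- w) xi 0 i.

Lemma spectral_density_monomial s a w : spectral_density s a ->
  spectral_density s (fun xi => monomial w xi * a xi).
Proof.
move=> da; elim: w => [|i w /(spectral_density_coord i)].
  by rewrite /monomial; under eq_fun do rewrite big_nil mul1r.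
by rewrite /monomial; under [X in _ -> _ X]eq_fun do rewrite big_cons -mulrA.
Qed.

Lemma iter_derive_ctrans s a b w :
  spectral_density s a -> spectral_density s b ->
  iter_derive w (fun x => ctrans a 0 x + ctrans b (pi / 2) x) =
  (fun x => ctrans (fun xi => monomial w xi * a xi) (0 + (size w)%:R * (pi / 2)) x +
     ctrans (fun xi => monomial w xi * b xi) (pi / 2 + (size w)%:R * (pi / 2)) x).
Proof.
move=> da db; elim: w => [|i w /= ->].
  rewrite /monomial; apply/funext => x /=; rewrite mul0r !addr0.
  by congr (_ + _); apply: eq_Rintegral => xi _; rewrite big_nil mul1r.
have da' := spectral_density_monomial w da.
have db' := spectral_density_monomial w db.
apply/funext => x.
rewrite (@derive_val _ _ _ _ _ _ _
  (is_deriveD (is_derive_ctrans _ x i da') (is_derive_ctrans _ x i db'))).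
have E (t : R) : t + (size w)%:R * (pi / 2) + pi / 2 = t + (size w).+1%:R * (pi / 2).
  by rewrite -natr1; ring.
rewrite !E /monomial.
by congr (_ + _); apply: eq_Rintegral => xi _; rewrite big_cons !mulrA.
Qed.

Lemma ctrans_sum s a th x (I : eqType) (r : seq I) (c : I -> R) (m : I -> 'rV[R]_n -> R) :
  spectral_density s a ->
  (forall i, spectral_density s (fun xi => m i xi * a xi)) ->
  spectral_density s (fun xi => (\sum_(i <- r) c i * m i xi) * a xi) /\
  ctrans (fun xi => (\sum_(i <- r) c i * m i xi) * a xi) th x =
  \sum_(i <- r) c i * ctrans (fun xi => m i xi * a xi) th x.
Proof.
move=> [ia za] dm; elim: r => [|i r [[IH1 IH2] IH3]].
  split; first split.
  - under [X in integrable _ _ (_ \o X)]eq_fun do rewrite big_nil.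
    exact: integrable_EFinZ.
  - by move=> xi /za ->; rewrite mulr0.
  - rewrite big_nil; under [LHS]eq_Rintegral do rewrite big_nil mul0r mulr0.
    by rewrite Rintegral_cst// mul0r.
have [i1 z1] := dm i.
have E : (fun xi => (\sum_(j <- i :: r) c j * m j xi) * a xi) =
    (fun xi => c i * (m i xi * a xi) + (\sum_(j <- r) c j * m j xi) * a xi).
  by apply/funext => xi; rewrite big_cons mulrDl mulrA.
have i2 := integrable_EFinZ (c i) measurableT i1.
rewrite E; split; first split.
- exact: integrable_EFinD.
- by move=> xi cxi; rewrite z1// IH2// mulr0 addr0.
- by rewrite ctransD// ctransZ// IH3 big_cons.
Qed.

(** [M] is chosen before [N], so the remainder tends to 0 as [N] grows, whatever the size of K. *)
Lemma band_real_taylor s u x v K : 0 <= s -> band_real s u ->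
  (forall xi, cube s xi -> `|dotr v xi| <= K) ->
  exists2 M, 0 <= M & forall N,
    `|u (x + v) - \sum_(k < N) (\sum_(w <- words k) monomial w v * iter_derive w u x) / k`!%:R| <=
    K ^+ N / N`!%:R * M.
Proof.
move=> s0 bu vK; have [a [b [da db ->]]] := band_real_repr s0 bu.
exists (\int[leb]_xi `|a xi| + \int[leb]_xi `|b xi|).
  by rewrite addr_ge0// Rintegral_ge0.
move=> N.
have tE c th k : spectral_density s c ->
    ctrans (fun xi => dotr v xi ^+ k * c xi) th x =
    \sum_(w <- words k) monomial w v * ctrans (fun xi => monomial w xi * c xi) th x.
  move=> dc.
  have [_ <-] := ctrans_sum th x (words k) (fun w => monomial w v) dc
    (fun w => spectral_density_monomial w dc).
  apply: eq_Rintegral => xi _; rewrite /dotr sum_expr_words.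
  by congr (_ * (_ * _)); apply: eq_bigr => w _; rewrite big_split.
have -> : ctrans a 0 (x + v) + ctrans b (pi / 2) (x + v) -
   \sum_(k < N) (\sum_(w <- words k) monomial w v *
      iter_derive w (fun x => ctrans a 0 x + ctrans b (pi / 2) x) x) / k`!%:R =
   (ctrans a 0 (x + v) - \sum_(k < N)
     ctrans (fun xi => dotr v xi ^+ k * a xi) (0 + k%:R * (pi / 2)) x / k`!%:R) +
   (ctrans b (pi / 2) (x + v) - \sum_(k < N)
     ctrans (fun xi => dotr v xi ^+ k * b xi) (pi / 2 + k%:R * (pi / 2)) x / k`!%:R).
  rewrite addrACA -opprD -big_split/=; congr (_ - _); apply: eq_bigr => k _.
  rewrite -mulrDl !tE// -big_split/=; congr (_ / _).
  rewrite [LHS]big_seq [RHS]big_seq; apply: eq_bigr => w /mem_words wk.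
  by rewrite (iter_derive_ctrans w da db) wk mulrDr.
rewrite mulrDr (le_trans (ler_normD _ _))//; apply: lerD.
  exact: (ctrans_taylor _ _ _ da vK).
exact: (ctrans_taylor _ _ _ db vK).
Qed.

End taylor_words.

(** * Complex band-limited functions *)

Section complex_band_limited.
Context {R : realType} {n : nat}.
Notation leb := (@lebesgue_rV R n).
Notation normc := ComplexField.Normc.normc.
Local Open Scope complex_scope.
Implicit Types (f g : 'rV[R]_n -> R[i]) (u : 'rV[R]_n -> R) (x v xi : 'rV[R]_n)
  (w : seq 'I_n) (s : R).

Notation RE f := (fun x => complex.Re (f x)).
Notation IM f := (fun x => complex.Im (f x)).

Lemma fourierE g xi : cintegrable leb g -> fourier g xi =
  (ctrans (RE g) 0 xi - ctrans (IM g) (pi / 2) xi) +i*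
  (ctrans (RE g) (pi / 2) xi + ctrans (IM g) 0 xi).
Proof.
move=> [iu iv]; rewrite /fourier /cintegral /ctrans; congr (_ +i* _).
  rewrite -RintegralB//; try exact: integrable_cosM.
  apply: eq_Rintegral => y _; rewrite addr0 cosD_pihalf.
  by case: (g y) => a b /=; rewrite cosN sinN; ring.
rewrite -RintegralD//; try exact: integrable_cosM.
apply: eq_Rintegral => y _; rewrite addr0 cosD_pihalf.
by case: (g y) => a b /=; rewrite cosN sinN; ring.
Qed.

Lemma ctransN u xi : leb.-integrable setT (EFin \o u) ->
  ctrans u 0 (- xi) = ctrans u 0 xi /\
  ctrans u (pi / 2) (- xi) = - ctrans u (pi / 2) xi.
Proof.
move=> iu.
have dN y : dotr (- xi) y = - dotr xi y.
  by rewrite -scaleN1r dotrZl mulN1r.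
split; first by apply: eq_Rintegral => y _; rewrite dN !addr0 cosN.
rewrite -mulN1r -RintegralZl//; last exact: integrable_cosM.
by apply: eq_Rintegral => y _; rewrite dN !cosD_pihalf sinN; ring.
Qed.

Lemma closed_cube s : closed (@cube R n s).
Proof.
have -> : @cube R n s = (fun x : 'rV[R]_n => `|x|) @^-1` [set r | r <= s] by [].
apply: preimage_closed; last exact: closed_le.
by move=> x _; exact: norm_continuous.
Qed.

(** For a real function the transform is even at phase 0 and odd at phase pi / 2. As the cube is
    symmetric, the vanishing of [fourier g] at both xi and -xi separates the real part of g from its
    imaginary part. Conversely the closure of the support stays in the cube because the cube is
    closed. *)
Lemma band_limitedP (mu : {measure set 'rV[R]_n -> \bar R}) (X : banach_lattice mu) s g :
  band_limited X s g <-> [/\ X g, band_real s (RE g) & band_real s (IM g)].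
Proof.
split=> [[Xg [iu iv] [cu cv] supp]|[Xg [iu cu u0] [iv cv v0]]].
  have F0 xi : ~ cube s xi -> fourier g xi = 0.
    move=> cxi; apply/eqP; apply: contrapT => /negP gxi; apply: cxi.
    by apply: supp; exact: subset_closure.
  have key xi : ~ cube s xi -> [/\ ctrans (RE g) 0 xi = 0, ctrans (RE g) (pi / 2) xi = 0,
      ctrans (IM g) 0 xi = 0 & ctrans (IM g) (pi / 2) xi = 0].
    move=> cxi; have cNxi : ~ cube s (- xi) by rewrite /cube/= normrN.
    have := F0 _ cxi; have := F0 _ cNxi; rewrite !fourierE//.
    have [-> ->] := ctransN xi iu; have [-> ->] := ctransN xi iv.
    by move=> [e1 e2] [e3 e4]; split; lra.
  by split => //; split => // xi /key[].
split => //.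
apply: (subset_trans (closure_subset _) (@closed_cube s)) => xi /= /eqP; apply: contra_notP => cxi.
have [e1 e2] := u0 _ cxi; have [e3 e4] := v0 _ cxi.
by rewrite fourierE// e1 e2 e3 e4 subr0 addr0.
Qed.

Lemma band_limited_partial_derivative (mu : {measure set 'rV[R]_n -> \bar R})
    (X : banach_lattice mu) s g i : 0 < s -> band_limited X s g ->
  X (partial_derivative i g) -> band_limited X s (partial_derivative i g).
Proof.
move=> s0 /band_limitedP[_ bu bv] Xg; apply/band_limitedP; split => //.
  exact: (band_real_derive i s0 bu).
exact: (band_real_derive i s0 bv).
Qed.

Definition iter_pd w g := foldr (fun i f => partial_derivative i f) g w.

Lemma iter_pdE w g :
  RE (iter_pd w g) = iter_derive w (RE g) /\ IM (iter_pd w g) = iter_derive w (IM g).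
Proof.
by elim: w => [//|i w [/= <- <-]].
Qed.

(** Index k stands for order k + 1, the term of order 0 being g x itself. The displacement enters
    only through the bound [dl] on its coordinates. *)
Definition taylor_term (dl : R) g k x : R :=
  dl ^+ k.+1 / (k.+1)`!%:R * \sum_(w <- words k.+1) normc (iter_pd w g x).

Lemma monomial_le w v dl : (forall i, `|v 0 i| <= dl) -> `|monomial w v| <= dl ^+ size w.
Proof.
move=> vdl; rewrite /monomial; elim: w => [|i w IH]; first by rewrite big_nil normr1.
by rewrite big_cons normrM exprS ler_pM.
Qed.

Lemma band_limited_taylor s g x v dl : 0 <= s -> 0 <= dl ->
  band_real s (RE g) -> band_real s (IM g) -> (forall i, `|v 0 i| <= dl) ->
  exists2 M, 0 <= M & forall N, normc (g (x + v) - g x) <=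
    \sum_(k < N) taylor_term dl g k x + (n%:R * dl * s) ^+ N.+1 / (N.+1)`!%:R * M.
Proof.
move=> s0 dl0 bu bv vdl.
have vK xi : cube s xi -> `|dotr v xi| <= n%:R * dl * s.
  move=> /dotr_le/le_trans; apply; rewrite ler_wpM2r// ler_wpM2l//.
  exact: normr_rV_le.
have [M M0 uM] := band_real_taylor x s0 bu vK.
have [M' M'0 vM] := band_real_taylor x s0 bv vK.
exists (M + M'); first exact: addr_ge0.
move=> N.
pose T k : R[i] := ((k.+1)`!%:R^-1)%:C *
  \sum_(w <- words k.+1) (monomial w v)%:C * iter_pd w g x.
have -> : g (x + v) - g x = \sum_(k < N) T k + (g (x + v) - g x - \sum_(k < N) T k).
  by rewrite [RHS]addrC subrK.
apply: (le_trans (normc_leD _ _)); apply: lerD.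
  apply: (le_trans (normc_sum _ _)); apply: ler_sum => k _.
  rewrite /T normc_rM ger0_norm ?invr_ge0// /taylor_term mulrAC [leRHS]mulrC.
  rewrite ler_wpM2l ?invr_ge0//.
  apply: (le_trans (normc_sum _ _)); rewrite mulr_sumr big_seq [leRHS]big_seq.
  apply: ler_sum => w /mem_words wk; rewrite normc_rM ler_wpM2r ?normc_ge0//.
  by have := monomial_le w vdl; rewrite wk.
apply: (le_trans (normc_le_ReIm _)); rewrite mulrDr; apply: lerD.
  have := uM N.+1; rewrite big_ord_recl /= fact0 divr1 big_seq1 /monomial big_nil mul1r /=.
  rewrite !ReB Re_sum opprD addrA; congr (`|_ - _| <= _).
  apply: eq_bigr => k _; rewrite /T Re_rM Re_sum mulrC; congr (_ * _).
  by apply: eq_bigr => w _; rewrite Re_rM; have [<- _] := iter_pdE w g.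
have := vM N.+1; rewrite big_ord_recl /= fact0 divr1 big_seq1 /monomial big_nil mul1r /=.
rewrite !ImB Im_sum opprD addrA; congr (`|_ - _| <= _).
apply: eq_bigr => k _; rewrite /T Im_rM Im_sum mulrC; congr (_ * _).
by apply: eq_bigr => w _; rewrite Im_rM; have [_ <-] := iter_pdE w g.
Qed.

(** Any common bound [F] of the partial sums suffices; such a bound is what completeness of the
    lattice provides almost everywhere. *)
Lemma normc_diff_le s g x v dl F : 0 <= s -> 0 <= dl ->
  band_real s (RE g) -> band_real s (IM g) -> (forall i, `|v 0 i| <= dl) ->
  (forall N, \sum_(k < N) taylor_term dl g k x <= F) ->
  normc (g (x + v) - g x) <= F.
Proof.
move=> s0 dl0 bu bv vdl TF.
have [M M0 H] := band_limited_taylor x s0 dl0 bu bv vdl.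
have cv : F + (n%:R * dl * s) ^+ N.+1 / (N.+1)`!%:R * M @[N --> \oo] --> F + 0 * M.
  apply: cvgD; first exact: cvg_cst.
  apply: cvgM; last exact: cvg_cst.
  have := @cvg_exp_coeff R (n%:R * dl * s).
  by rewrite -cvg_shiftS.
rewrite mul0r addr0 in cv.
apply: (ler_cvg_to (cvg_cst (normc (g (x + v) - g x))) cv).
by apply: nearW => N; rewrite (le_trans (H N))// lerD2r.
Qed.

End complex_band_limited.

(** * Series in a Banach lattice *)

Section banach_lattice_theory.
Context {R : realType} {n : nat} {mu : {measure set 'rV[R]_n -> \bar R}}.
Context (X : banach_lattice mu).
Notation normc := ComplexField.Normc.normc.
Local Open Scope complex_scope.
Implicit Types (f g : 'rV[R]_n -> R[i]).

Lemma Re_le_normc (z : R[i]) : complex.Re z <= normc z.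
Proof.
case: z => a b /=; rewrite (le_trans (ler_norm _))// -sqrtr_sqr ler_sqrt ?lerDl ?sqr_ge0//.
by rewrite addr_ge0 ?sqr_ge0.
Qed.

Lemma normcN1 : normc (-1 : R[i]) = 1.
Proof. by rewrite /= oppr0 expr0n addr0 sqrtr_sqr normrN1. Qed.

Lemma bl_norm0 : bl_norm X (fun=> 0) = 0.
Proof.
have := bl_normZ 0 (bl_carrier0 X); rewrite ComplexField.Normc.normc0 [RHS]mul0r => <-.
by congr bl_norm; apply/funext => x; rewrite mul0r.
Qed.

Lemma bl_norm_ge0 f : X f -> 0 <= bl_norm X f.
Proof.
move=> Xf; have Xg := bl_carrierZ (-1) Xf.
have := bl_normD Xf Xg; rewrite bl_normZ// normcN1 mul1r.
have -> : (fun x => f x + -1 * f x) = (fun=> 0).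
  by apply/funext => x; rewrite mulN1r subrr.
by rewrite bl_norm0; lra.
Qed.

Lemma bl_carrierB f g : X f -> X g -> X (fun x => f x - g x).
Proof.
move=> Xf Xg; have := bl_carrierD Xf (bl_carrierZ (-1) Xg).
by congr bl_carrier; apply/funext => x; rewrite mulN1r.
Qed.

Lemma bl_solid_real (u : 'rV[R]_n -> R) g : measurable_fun setT u -> X g ->
  {ae mu, forall x, `|u x| <= normc (g x)} ->
  X (fun x => (u x)%:C) /\ bl_norm X (fun x => (u x)%:C) <= bl_norm X g.
Proof.
move=> mu_ Xg ug; apply: bl_solid => //.
by apply: filterS ug => x; rewrite !normr_normc lecR normc_real.
Qed.

Lemma cmeasurable_normc f : cmeasurable f -> measurable_fun setT (fun x => normc (f x)).
Proof.
move=> [mr mi].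
have -> : (fun x => normc (f x)) =
    (fun x => Num.sqrt (complex.Re (f x) ^+ 2 + complex.Im (f x) ^+ 2)).
  by apply/funext => x; case: (f x).
apply: measurableT_comp.
  by apply: continuous_measurable_fun; exact: sqrt_continuous.
by apply: measurable_funD; exact: measurable_funX.
Qed.

Lemma bl_normc f : X f -> X (fun x => (normc (f x))%:C) /\
  bl_norm X (fun x => (normc (f x))%:C) <= bl_norm X f.
Proof.
move=> Xf; apply: bl_solid_real => //.
  exact: cmeasurable_normc (bl_measurable Xf).
by apply: aeW => x; rewrite ger0_norm// normc_ge0.
Qed.

Lemma bl_sum (I : Type) (r : seq I) (F : I -> 'rV[R]_n -> R) :
  (forall i, X (fun x => (F i x)%:C)) ->
  X (fun x => (\sum_(i <- r) F i x)%:C) /\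
  bl_norm X (fun x => (\sum_(i <- r) F i x)%:C) <=
    \sum_(i <- r) bl_norm X (fun x => (F i x)%:C).
Proof.
move=> XF; elim: r => [|i r [IH1 IH2]].
  by under eq_fun do rewrite big_nil; rewrite big_nil bl_norm0; split => //; exact: bl_carrier0.
have -> : (fun x => (\sum_(j <- i :: r) F j x)%:C) =
    (fun x => (F i x)%:C + (\sum_(j <- r) F j x)%:C).
  by apply/funext => x; rewrite big_cons rmorphD.
rewrite big_cons; split; first exact: bl_carrierD.
by rewrite (le_trans (bl_normD (XF i) IH1))// lerD2l.
Qed.

Lemma bl_scale (k : R) (F : 'rV[R]_n -> R) : 0 <= k -> X (fun x => (F x)%:C) ->
  X (fun x => (k * F x)%:C) /\
  bl_norm X (fun x => (k * F x)%:C) = k * bl_norm X (fun x => (F x)%:C).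
Proof.
move=> k0 XF.
have -> : (fun x => (k * F x)%:C) = (fun x => k%:C * (F x)%:C).
  by apply/funext => x; rewrite rmorphM.
split; first exact: bl_carrierZ.
by rewrite bl_normZ// normc_real ger0_norm.
Qed.

(** The numbers [C N] increase to a limit and control the distances between partial sums, so these
    converge in norm. The pointwise claim is domination by the limit, which is recovered from the
    lattice order. *)
Lemma riesz_fischer (f : nat -> 'rV[R]_n -> R) (S : R) :
  (forall k x, 0 <= f k x) -> (forall k, X (fun x => (f k x)%:C)) ->
  (forall N, \sum_(k < N) bl_norm X (fun x => (f k x)%:C) <= S) ->
  exists F, [/\ X F, bl_norm X F <= S &
    {ae mu, forall x, forall N, \sum_(k < N) f k x <= normc (F x)}].
Proof.
move=> f0 Xf fS.
pose c k := bl_norm X (fun x => (f k x)%:C).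
have c0 k : 0 <= c k by exact: bl_norm_ge0.
pose s N (x : 'rV[R]_n) : R := \sum_(k < N) f k x.
have Xs N : X (fun x => (s N x)%:C).
  by have [] := bl_sum (index_enum 'I_N) (fun k : 'I_N => Xf k).
have s_le N : bl_norm X (fun x => (s N x)%:C) <= S.
  have [_] := bl_sum (index_enum 'I_N) (fun k : 'I_N => Xf k).
  by move=> /le_trans; apply; exact: fS.
pose C N := \sum_(k < N) c k.
have s_dist m N : (m <= N)%N -> bl_norm X (fun x => (s N x)%:C - (s m x)%:C) <= C N - C m.
  move=> mN.
  have split_sum (V : zmodType) (F : nat -> V) :
      \sum_(k < N) F k - \sum_(k < m) F k = \sum_(m <= k < N) F k.
    by rewrite -!(big_mkord xpredT F) (big_cat_nat (leq0n m) mN)/= addrAC subrr add0r.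
  have [_] := bl_sum (index_iota m N) Xf.
  rewrite /C (split_sum _ c); congr (bl_norm X _ <= _).
  by apply/funext => x; rewrite /s -rmorphB/= (split_sum _ (fun k => f k x)).
have norm_sym f1 g1 : X f1 -> X g1 ->
    bl_norm X (fun x => f1 x - g1 x) = bl_norm X (fun x => g1 x - f1 x).
  move=> X1 X2; have := bl_normZ (-1) (bl_carrierB X2 X1).
  rewrite normcN1 mul1r => <-.
  by congr bl_norm; apply/funext => x; rewrite mulN1r opprB.
have cC : cvgn C.
  apply: nondecreasing_is_cvgn.
    by apply/nondecreasing_seqP => k; rewrite /C big_ord_recr lerDl.
  by exists S => _ [N _ <-]; exact: fS.
have [|F XF sF] := bl_complete (Xs).
  move=> e e0; have e20 : 0 < e / 2 by rewrite divr_gt0.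
  have [l cl] := iffLR (cvg_ex _) cC.
  move/cvgrPdist_lt : cl => /(_ _ e20)[N _ cN].
  have dist a b : (N <= a)%N -> (a <= b)%N -> C b - C a < e.
    move=> Na ab; have := cN a Na; have := cN b (leq_trans Na ab) => /=.
    rewrite !ltr_norml => /andP[h1 h2] /andP[h3 h4]; lra.
  exists N => a b Na Nb; have [ab|/ltnW ba] := leqP a b.
    by rewrite norm_sym// (le_lt_trans (s_dist _ _ ab))// dist.
  by rewrite (le_lt_trans (s_dist _ _ ba))// dist.
exists F; split => //.
- have cv : S + bl_norm X (fun x => (s k x)%:C - F x) @[k --> \oo] --> S + 0.
    by apply: cvgD; [exact: cvg_cst|exact: sF].
  rewrite addr0 in cv.
  apply: (ler_cvg_to (cvg_cst (bl_norm X F)) cv); apply: nearW => k.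
  have -> : bl_norm X F = bl_norm X (fun x => (s k x)%:C + (F x - (s k x)%:C)).
    by congr bl_norm; apply/funext => x; rewrite addrC subrK.
  rewrite norm_sym// (le_trans (bl_normD (Xs k) (bl_carrierB XF (Xs k))))//.
  by rewrite lerD2r.
- apply: ae_foralln => N.
  (* The excess of s N over F. For m >= N it is at most |s m - F|, because the partial sums
     increase; so its norm is below a sequence tending to 0, and it vanishes almost everywhere. *)
  pose h x : R := Num.max 0 (s N x - complex.Re (F x)).
  have mh : measurable_fun setT h.
    apply: measurable_maxr; first exact: measurable_cst.
    apply: measurable_funB; last by have [] := bl_measurable XF.
    by have [] := bl_measurable (Xs N).
  have hm m : (N <= m)%N -> X (fun x => (h x)%:C) /\
      bl_norm X (fun x => (h x)%:C) <= bl_norm X (fun x => (s m x)%:C - F x).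
    move=> Nm; apply: bl_solid_real => //; first exact: bl_carrierB.
    apply: aeW => x; rewrite ger0_norm ?le_max ?lexx// /h ge_max normc_ge0/=.
    apply: (@le_trans _ _ (complex.Re ((s m x)%:C - F x))).
      rewrite ReB lerB// /s -!(big_mkord xpredT (fun k => f k x)).
      by rewrite [leRHS](big_cat_nat (leq0n N) Nm)//= lerDl sumr_ge0.
    exact: Re_le_normc.
  have [Xh _] := hm N (leqnn N).
  have h0 : bl_norm X (fun x => (h x)%:C) = 0.
    apply/eqP; rewrite eq_le bl_norm_ge0// andbT.
    apply: (ler_cvg_to (cvg_cst _) sF); near=> m.
    by apply: (hm _ _).2; near: m; exact: nbhs_infty_ge.
  have := iffLR (bl_norm_eq0 Xh) h0; apply: filterS => x [hx].
  apply: le_trans (Re_le_normc (F x)).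
  by rewrite -subr_le0 -/(s N x) -hx le_max lexx orbT.
Unshelve. all: by end_near. Qed.

End banach_lattice_theory.

(** * Sampling *)

Section sampling_sums.
Context {R : realType} {d : nat}.
Notation normc := ComplexField.Normc.normc.
Implicit Types (x y : 'rV[R]_d) (k : 'rV[int]_d) (W : R).

(** The index of the half-open cube, closed at its upper faces, that contains x; these cubes
    partition the space. *)
Definition cell W x : 'rV[int]_d := \row_i Num.ceil (W * x 0 i).

(* If [x] lies in [grid_cube W k] then each [k 0 i] is [ceil (W * x 0 i)] or, on
   a common face, its successor. *)
Definition upper_neighbours k : seq 'rV[int]_d :=
  undup [seq k + \row_i (b i : nat)%:Z | b : {ffun 'I_d -> bool}].

Lemma size_upper_neighbours k : (size (upper_neighbours k) <= 2 ^ d)%N.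
Proof.
apply: (leq_trans (size_undup _)).
by rewrite size_map -cardE card_ffun card_bool card_ord.
Qed.

Lemma cell_upper_neighbours W x : cell W x \in upper_neighbours (cell W x).
Proof.
rewrite mem_undup; apply/mapP; exists [ffun=> false]; first by rewrite mem_enum.
by apply/rowP => i; rewrite !mxE ffunE addr0.
Qed.

Lemma grid_cube_cell W x : 0 < W -> grid_cube W (cell W x) x.
Proof.
move=> W0 i; rewrite mxE ler_pdivrMr// ler_pdivlMr// ![_ * W]mulrC.
by have /andP[/ltW -> ->] := ceil_itv (W * x 0 i).
Qed.

Lemma grid_cube_upper_neighbours W x k : 0 < W -> grid_cube W k x ->
  k \in upper_neighbours (cell W x).
Proof.
move=> W0 kx; rewrite mem_undup; apply/mapP.
exists [ffun i => k 0 i != Num.ceil (W * x 0 i)]; first by rewrite mem_enum.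
apply/rowP => i; rewrite !mxE ffunE.
have := kx i; rewrite ler_pdivrMr// ler_pdivlMr// ![_ * W]mulrC => /andP[k1 k2].
have /andP[c1 c2] := ceil_itv (W * x 0 i).
move: k1 k2 c1 c2; set c := Num.ceil _; set z := W * _ => k1 k2 c1 c2.
have h1 : (c <= k 0 i)%R by rewrite ceil_le_int.
have h2 : (k 0 i - 1 <= c)%R by rewrite -(ler_int R) (le_trans k1).
by have [->|] := eqVneq (k 0 i) c => /=; lia.
Qed.

Lemma measurable_grid_cube W k : measurable (grid_cube W k : set 'rV[R]_d).
Proof.
have -> : grid_cube W k = \bigcap_(i in [set: 'I_d])
    ((fun x : 'rV[R]_d => x 0 i) @^-1` `[(k 0 i - 1)%:~R / W, (k 0 i)%:~R / W]).
  apply/seteqP; split=> x xk i; first by move=> _; rewrite /= in_itv/=; exact: xk.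
  by have := xk i I; rewrite /= in_itv.
apply: fin_bigcap_measurable => // i _.
by rewrite -[X in measurable X]setTI; exact: measurable_coord.
Qed.

Lemma measurable_cell W k : measurable (cell W @^-1` [set k]).
Proof.
have -> : cell W @^-1` [set k] = \bigcap_(i in [set: 'I_d])
    ((fun x : 'rV[R]_d => W * x 0 i) @^-1` `](k 0 i - 1)%:~R, (k 0 i)%:~R]).
  apply/seteqP; split=> x /=.
    by move=> <- i _; rewrite /= in_itv/= mxE; exact: ceil_itv.
  move=> xk; apply/rowP => i; rewrite mxE; apply/eqP; rewrite ceil_eq.
  by have := xk i I; rewrite /= in_itv.
apply: fin_bigcap_measurable => // i _.
rewrite -[X in measurable X]setTI.
have mW : measurable_fun setT (fun x : 'rV[R]_d => W * x 0 i).
  by apply: measurable_funM => //; exact: measurable_coord.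
by apply: mW => //.
Qed.

Lemma measurable_fun_cells (T : countType) (K : 'rV[R]_d -> T)
    (F : T -> 'rV[R]_d -> R) :
  (forall l, measurable (K @^-1` [set l])) -> (forall l, measurable_fun setT (F l)) ->
  measurable_fun setT (fun x => F (K x) x).
Proof.
move=> mK mF _ Y mY; rewrite setTI.
have -> : (fun x => F (K x) x) @^-1` Y = \bigcup_l (K @^-1` [set l] `&` F l @^-1` Y).
  apply/seteqP; split=> x /=; first by move=> Fx; exists (K x).
  by move=> [l _ [<-]].
apply: countable_bigcupT_measurable; first exact: countableP.
by move=> l; apply: measurableI => //; rewrite -[X in measurable X]setTI; exact: mF.
Qed.

Definition sampling_sum W (c : 'rV[int]_d -> R) x : R :=
  \sum_(k <- upper_neighbours (cell W x)) c k * \1_(grid_cube W k) x.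

Lemma samplingE W t (g : 'rV[R]_d -> R[i]) : 0 < W ->
  sampling W t g = (fun x => (sampling_sum W (fun k => normc (g (t k))) x)%:C%C).
Proof.
move=> W0; apply/funext => x; rewrite /sampling; congr (_%:C)%C.
rewrite /sampling_sum [RHS]fsbig_seq ?undup_uniq//.
apply/esym; apply: fsbig_widen => // k [_ /= kx].
rewrite indicE memNset ?mulr0// => kx'; apply: kx.
exact: grid_cube_upper_neighbours.
Qed.

(** On each of the countably many cells the list of neighbours is fixed, and the sum is a finite
    combination of indicators. *)
Lemma measurable_sampling_sum W c : measurable_fun setT (sampling_sum W c).
Proof.
apply: (@measurable_fun_cells _ (cell W)
  (fun l x => \sum_(k <- upper_neighbours l) c k * \1_(grid_cube W k) x)).
  exact: measurable_cell.
move=> l; apply: measurable_sum => k; apply: measurable_funM => //.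
by apply: measurable_indic; exact: measurable_grid_cube.
Qed.

Lemma sampling_sum_ge W c x : 0 < W -> (forall k, 0 <= c k) ->
  c (cell W x) <= sampling_sum W c x.
Proof.
move=> W0 c0; rewrite /sampling_sum (bigD1_seq (cell W x))//=; last 2 first.
- exact: cell_upper_neighbours.
- exact: undup_uniq.
rewrite indicE mem_set ?mulr1; last exact: grid_cube_cell.
by rewrite lerDl sumr_ge0// => k _; rewrite mulr_ge0.
Qed.

Lemma sampling_sum_le W c x b : 0 <= b -> (forall k, grid_cube W k x -> c k <= b) ->
  sampling_sum W c x <= 2 ^+ d * b.
Proof.
move=> b0 cb; apply: (@le_trans _ _ (\sum_(k <- upper_neighbours (cell W x)) b)).
  apply: ler_sum => k _; rewrite indicE.
  have [kx|kx] := pselect (grid_cube W k x); first by rewrite mem_set// mulr1 cb.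
  by rewrite memNset// mulr0.
rewrite big_const_seq count_predT iter_addr addr0 -[b *+ _]mulr_natl ler_wpM2r//.
by rewrite -natrX ler_nat size_upper_neighbours.
Qed.

Lemma grid_cube_dist W k x y i : 0 < W -> grid_cube W k x -> grid_cube W k y ->
  `|(x - y) 0 i| <= W^-1.
Proof.
move=> W0 /(_ i)/andP[x1 x2] /(_ i)/andP[y1 y2]; rewrite !mxE.
move: x1 x2 y1 y2; rewrite intrB mulrBl div1r => x1 x2 y1 y2.
by rewrite ler_norml; lra.
Qed.

End sampling_sums.

(** * The two-sided estimate *)

Section sampling_theorem.
Context {R : realType} {d : nat} {mu : {measure set 'rV[R]_d -> \bar R}}.
Context (X : banach_lattice mu) (B : R) (B_gt0 : 0 < B).
Context (bernstein : forall (sigma : R) (g : 'rV[R]_d -> R[i]),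
  0 < sigma -> band_limited X sigma g ->
  forall i : 'I_d, X (partial_derivative i g) /\
    bl_norm X (partial_derivative i g) <= B * sigma * bl_norm X g).
Notation normc := ComplexField.Normc.normc.

Lemma iter_pd_bernstein sigma g w : 0 < sigma -> band_limited X sigma g ->
  band_limited X sigma (iter_pd w g) /\
  bl_norm X (iter_pd w g) <= (B * sigma) ^+ size w * bl_norm X g.
Proof.
move=> s0 bg; elim: w => [|i w [IH1 IH2]] /=; first by rewrite mul1r.
have [X1 le1] := bernstein s0 IH1 i; split.
  exact: band_limited_partial_derivative.
apply: (le_trans le1); rewrite exprS -[leRHS]mulrA ler_wpM2l// mulr_ge0//; exact: ltW.
Qed.

Lemma taylor_term_norm sigma dl g k : 0 < sigma -> 0 <= dl -> band_limited X sigma g ->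
  X (fun x => (taylor_term dl g k x)%:C%C) /\
  bl_norm X (fun x => (taylor_term dl g k x)%:C%C) <=
    (d%:R * B * sigma * dl) ^+ k.+1 / (k.+1)`!%:R * bl_norm X g.
Proof.
move=> s0 dl0 bg; have [Xg _ _ _] := bg.
have Xw w : X (fun x => (normc (iter_pd w g x))%:C%C).
  by have [[Xpd _ _ _] _] := iter_pd_bernstein w s0 bg; have [] := bl_normc Xpd.
have [Xsum sum_le] := bl_sum (words k.+1 : seq (seq 'I_d)) Xw.
have c0 : 0 <= dl ^+ k.+1 / (k.+1)`!%:R by rewrite divr_ge0// exprn_ge0.
have [XT ->] := bl_scale c0 Xsum; split => //.
apply: (@le_trans _ _ (dl ^+ k.+1 / (k.+1)`!%:R *
    \sum_(w <- words k.+1 : seq (seq 'I_d)) (B * sigma) ^+ k.+1 * bl_norm X g)).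
  rewrite ler_wpM2l// (le_trans sum_le)// big_seq [leRHS]big_seq.
  apply: ler_sum => w /mem_words wk.
  have [[Xpd _ _ _] le1] := iter_pd_bernstein w s0 bg.
  by have [_ /le_trans] := bl_normc Xpd; apply; rewrite -wk.
rewrite big_const_seq count_predT iter_addr addr0 size_words -[_ *+ (d ^ _)%N]mulr_natl natrX.
rewrite [leRHS](_ : _ = dl ^+ k.+1 / (k.+1)`!%:R *
    (d%:R ^+ k.+1 * ((B * sigma) ^+ k.+1 * bl_norm X g))) //.
by rewrite -!mulrA !exprMn; ring.
Qed.

Lemma sum_exp_coeff_le (b : R) N : 0 <= b ->
  \sum_(k < N) b ^+ k.+1 / (k.+1)`!%:R <= expR b - 1.
Proof.
move=> b0; rewrite lerBrDl.
have E k : exp_coeff b k = b ^+ k / k`!%:R by [].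
have -> : 1 + \sum_(k < N) b ^+ k.+1 / (k.+1)`!%:R = series (exp_coeff b) N.+1.
  by rewrite /series/= big_mkord big_ord_recl E expr0 fact0 divr1.
rewrite /expR.
apply: nondecreasing_cvgn_le; last exact: is_cvg_series_exp_coeff.
apply/nondecreasing_seqP => k; rewrite /series/= big_nat_recr//= lerDl.
by rewrite E divr_ge0// exprn_ge0.
Qed.

Lemma sampling_norm sigma W q g t : 0 < sigma -> 0 < W -> band_limited X sigma g ->
  expR (d%:R * B * sigma * W^-1) - 1 <= q ->
  (forall k, grid_cube W k (t k)) ->
  [/\ X (sampling W t g),
      bl_norm X (sampling W t g) <= 2 ^+ d * (1 + q) * bl_norm X g &
      (1 - q) * bl_norm X g <= bl_norm X (sampling W t g)].
Proof.
move=> s0 W0 bg qE tk; have [Xg _ _ _] := bg.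
have dl0 : 0 <= W^-1 by rewrite invr_ge0 ltW.
have g0 := bl_norm_ge0 Xg.
have [F [XF F_le FT]] : exists F, [/\ X F, bl_norm X F <= q * bl_norm X g &
    {ae mu, forall x, forall N, \sum_(k < N) taylor_term W^-1 g k x <= normc (F x)}].
  apply: riesz_fischer.
  - move=> k x; rewrite /taylor_term mulr_ge0//; first by rewrite divr_ge0// exprn_ge0.
    by rewrite sumr_ge0// => w _; exact: normc_ge0.
  - by move=> k; have [] := taylor_term_norm k s0 dl0 bg.
  - move=> N; apply: (@le_trans _ _ ((\sum_(k < N)
        (d%:R * B * sigma * W^-1) ^+ k.+1 / (k.+1)`!%:R) * bl_norm X g)).
      rewrite mulr_suml; apply: ler_sum => k _.
      by have [] := taylor_term_norm k s0 dl0 bg.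
    rewrite ler_wpM2r// (le_trans _ qE)// sum_exp_coeff_le//.
    by rewrite !mulr_ge0// ltW.
have [_ bu bv] := iffLR (band_limitedP X sigma g) bg.
pose c k := normc (g (t k)).
have c0 k : 0 <= c k by exact: normc_ge0.
have dist x k : (forall N, \sum_(k < N) taylor_term W^-1 g k x <= normc (F x)) ->
    grid_cube W k x -> normc (g (t k) - g x) <= normc (F x).
  move=> xF kx; rewrite -(subrKC x (t k)).
  apply: (normc_diff_le (ltW s0) dl0 bu bv _ xF) => i.
  by apply: grid_cube_dist (tk k) kx.
have [XgN gN_le] := bl_normc Xg; have [XFN FN_le] := bl_normc XF.
have XgF : X (fun x => (normc (g x))%:C%C + (normc (F x))%:C%C)%C by exact: bl_carrierD.
have XD : X (fun x => (2 ^+ d)%:C%C * ((normc (g x))%:C%C + (normc (F x))%:C%C))%C.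
  exact: bl_carrierZ.
have mS := measurable_sampling_sum W c.
(* Almost everywhere each sample whose cube contains x is at most |g x| + |F x|, and at most 2^d
   indices contribute. *)
have [XS S_le] : X (fun x => (sampling_sum W c x)%:C%C) /\
    bl_norm X (fun x => (sampling_sum W c x)%:C%C) <=
    bl_norm X (fun x => (2 ^+ d)%:C%C * ((normc (g x))%:C%C + (normc (F x))%:C%C))%C.
  apply: bl_solid_real => //; apply: filterS FT => x xF.
  rewrite ger0_norm; last first.
    exact: le_trans (c0 _) (sampling_sum_ge x W0 c0).
  rewrite -rmorphD normc_rM ger0_norm ?exprn_ge0// normc_real ger0_norm ?addr_ge0 ?normc_ge0//.
  apply: sampling_sum_le; first by rewrite addr_ge0 ?normc_ge0.
  move=> k kx; have := dist _ _ xF kx; rewrite /c => dk.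
  rewrite -(subrK (g x) (g (t k))) addrC (le_trans (normc_leD _ _))// lerD2l//.
rewrite samplingE//; split => //.
- apply: (le_trans S_le); rewrite bl_normZ// normc_real ger0_norm ?exprn_ge0//.
  rewrite -mulrA ler_wpM2l ?exprn_ge0// (le_trans (bl_normD XgN XFN))// mulrDl mul1r.
  by rewrite lerD// (le_trans FN_le).
(* Only the sample of the cell of x is used: |g x| is at most that sample plus |F x|, which costs no
   factor 2^d. *)
- have XSF := bl_carrierD XS XFN.
  have [||_ g_le] := @bl_solid _ _ _ X g _ _ XSF.
  + exact: bl_measurable Xg.
  + apply: filterS FT => x xF; rewrite !normr_normc lecR.
    rewrite -rmorphD normc_real ger0_norm; last first.
      by rewrite addr_ge0 ?normc_ge0// (le_trans (c0 _) (sampling_sum_ge x W0 c0)).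
    have := dist _ _ xF (grid_cube_cell x W0).
    have := sampling_sum_ge x W0 c0; rewrite /c; set tx := t _ => S1 D1.
    rewrite -(subrK (g tx) (g x)) addrC (le_trans (normc_leD _ _))// lerD//.
    by rewrite -normcN opprB.
  + rewrite mulrBl mul1r lerBlDr (le_trans g_le)// (le_trans (bl_normD XS XFN))//.
    by rewrite lerD2l (le_trans FN_le).
Qed.

End sampling_theorem.

Theorem theorem6p2 (R : realType) (d : nat) (d_gt0 : (0 < d)%N)
  (mu : {sigma_finite_measure set 'rV[R]_d -> \bar R})
  (X : banach_lattice mu)
  (X_sub_L1 : forall f, X f -> cintegrable mu f)
  (eps B : R) (eps_gt0 : 0 < eps) (B_gt0 : 0 < B)
  (bernstein : forall (sigma : R) (g : 'rV[R]_d -> R[i]),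
    0 < sigma -> band_limited X sigma g ->
    forall i : 'I_d,
      X (partial_derivative i g) /\
      bl_norm X (partial_derivative i g) <= B * sigma * bl_norm X g) :
  exists c C : R, [/\ 0 < c, 0 < C &
    forall (sigma W : R) (g : 'rV[R]_d -> R[i]) (t : 'rV[int]_d -> 'rV[R]_d),
      0 < sigma -> band_limited X sigma g ->
      (d%:R * B / ln 2 + eps) * sigma <= W ->
      (forall k, grid_cube W k (t k)) ->
      [/\ X (sampling W t g),
          c * bl_norm X (sampling W t g) <= bl_norm X g &
          bl_norm X g <= C * bl_norm X (sampling W t g)]].
Proof.
have ln2 : 0 < ln 2 :> R by rewrite ln_gt0// ltr1n.
have dB : 0 < d%:R * B by rewrite mulr_gt0// ltr0n.
pose D := d%:R * B / ln 2 + eps.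
have D0 : 0 < D by rewrite addr_gt0// divr_gt0.
(* The value of exp(d B sigma / W) - 1 at the smallest admissible W = D sigma. There sigma cancels,
   so the constants depend on d, B and eps only. *)
pose q := expR (d%:R * B / D) - 1.
(* This amounts to d B < D ln 2 = d B + eps ln 2. *)
have q1 : q < 1.
  rewrite ltrBlDr -[ltRHS](@lnK R) ?posrE// ltr_expR.
  rewrite ltr_pdivrMr// (_ : 1 + 1 = 2)// /D mulrDr [ln _ * (_ / _)]mulrC divfK ?gt_eqF//.
  by rewrite ltrDl mulr_gt0.
have q0 : 0 <= q.
  by rewrite subr_ge0 -[leLHS]expR0 ler_expR divr_ge0 ?ltW.
have c0 : 0 < 2 ^+ d * (1 + q) by rewrite mulr_gt0 ?exprn_gt0// ltr_wpDr.
exists (2 ^+ d * (1 + q))^-1, (1 - q)^-1; split; rewrite ?invr_gt0 ?subr_gt0//.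
move=> sigma W g t s0 bg WD tk.
have W0 : 0 < W by apply: lt_le_trans WD; rewrite mulr_gt0.
have qW : expR (d%:R * B * sigma * W^-1) - 1 <= q.
  rewrite lerB// ler_expR -[leLHS]mulrA ler_wpM2l ?(ltW dB)//.
  by rewrite ler_pdivrMr// ler_pdivlMl.
have [XS S1 S2] := sampling_norm B_gt0 bernstein s0 W0 bg qW tk; split => //.
- by rewrite mulrC ler_pdivrMr// mulrC.
- by rewrite mulrC ler_pdivlMr ?subr_gt0// mulrC.
Qed.
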